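(* Let $\Gamma=(m_{i,j})_{i,j\in I}$ be a Coxeter matrix and let $\tilde I$ be an admissible partition of $\Gamma$ whose type $\tilde\Gamma=(|r_\alpha r_\beta|)_{\alpha,\beta\in\tilde I}$ is spherical. Let $\varphi_{\mathrm{gr}}:B_{\tilde\Gamma}\to B_\Gamma$ be the group homomorphism with $\mathbf s_\alpha\mapsto\mathbf r_\alpha$ for all $\alpha\in\tilde I$. Then $\varphi_{\mathrm{gr}}$ is injective. In other words, if $\tilde{\mathbf S}=\{\mathbf r_\alpha\mid\alpha\in\tilde I\}$ and $\tilde B$ is the subgroup of $B_\Gamma$ generated by $\tilde{\mathbf S}$, then the pair $(\tilde B,\tilde{\mathbf S})$ is isomorphic to the Artin-Tits system $(B_{\tilde\Gamma},\mathbf S_{\tilde\Gamma})$ of type $\tilde\Gamma$.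
   Context: A Coxeter matrix over an arbitrary (possibly infinite) set $I$ is a family $\Gamma=(m_{i,j})_{i,j\in I}$ with $m_{i,j}=m_{j,i}\in\mathbb N_{\geq 1}\cup\{\infty\}$ and $m_{i,j}=1\iff i=j$. For $n\in\mathbb N$, $\prod_n(x,y)$ is the alternating product $xyxy\cdots$ with $n$ factors starting with $x$. $W_\Gamma$ is the Coxeter group generated by $s_i$ ($i\in I$) with relations $s_i^2=1$ and $\prod_{m_{i,j}}(s_i,s_j)=\prod_{m_{i,j}}(s_j,s_i)$ if $m_{i,j}\ne\infty$. $B_\Gamma$ (resp. $B^+_\Gamma$) is the group (resp. monoid) presented by generators $\mathbf S_\Gamma=\{\mathbf s_i\mid i\in I\}$ and relations $\prod_{m_{i,j}}(\mathbf s_i,\mathbf s_j)=\prod_{m_{i,j}}(\mathbf s_j,\mathbf s_i)$ for $m_{i,j}\neq\infty$; $B^+_\Gamma$ is identified with the submonoid of $B_\Gamma$ generated by $\mathbf S_\Gamma$ (Paris' theorem). $(B_\Gamma,\mathbf S_\Gamma)$ is the Artin-Tits system of type $\Gamma$. Two pairs (group, generating set) are isomorphic if there is a group isomorphism carrying one generating set onto the other. $\ell$ denotes word length on $W_\Gamma$ with respect to $\{s_i\}$. For $w\in W_\Gamma$, $\mathbf w\in B^+_\Gamma$ is the element represented by any reduced word of $w$ (well defined by Tits' theorem). For $J\subseteq I$, $\Gamma_J=(m_{i,j})_{i,j\in J}$ and $W_J=\langle s_j\mid j\in J\rangle$. $J$ (or $\Gamma_J$) is spherical if $W_J$ is finite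 (in particular a Coxeter matrix $\Gamma$ is spherical if $W_\Gamma$ is finite); then $r_J$ is the unique element of maximal length in $W_J$ and $\mathbf r_J\in B^+_\Gamma$ is the corresponding element. A partition $\tilde I$ of $I$ (into non-empty parts) is spherical if every $\alpha\in\tilde I$ is spherical. Then $\tilde W=\langle r_\alpha\mid\alpha\in\tilde I\rangle\subseteq W_\Gamma$, and the type of $\tilde I$ is the Coxeter matrix $\tilde\Gamma=(|r_\alpha r_\beta|)_{\alpha,\beta\in\tilde I}$ of orders of the products $r_\alpha r_\beta$ in $W_\Gamma$. For $w\in W_\Gamma$, put $I^{\pm}(w)=\{i\in I\mid \ell(ws_i)=\ell(w)\pm1\}$. The partition $\tilde I$ is admissible if it is spherical and for all $(w,\alpha)\in\tilde W\times\tilde I$ either $\alpha\subseteq I^+(w)$ or $\alpha\subseteq I^-(w)$. When $\tilde I$ is admissible, the assignment $\mathbf s_\alpha\mapsto\mathbf r_\alpha$ extends to a monoid morphism $B^+_{\tilde\Gamma}\to B^+_\Gamma$, hence to a group homomorphism $\varphi_{\mathrm{gr}}:B_{\tilde\Gamma}\to B_\Gamma$. *)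

(* Defs.v *)
(* MathComp, with the classical axioms of MathComp-Analysis. *)
From HB Require Import structures.
From mathcomp Require Import all_boot.
From mathcomp Require Import boolp classical_sets cardinality.

Set Implicit Arguments.
Unset Strict Implicit.
Unset Printing Implicit Defensive.

Local Open Scope group_scope.
Local Open Scope classical_set_scope.
Local Open Scope quotient_scope.

Section GroupNotions.
Variable G : groupType.

(* [None] encodes infinite order. *)
Definition order (x : G) : option nat :=
  match pselect (exists n, (0 < n)%N && (x ^+ n == 1)) with
  | left ex => Some (ex_minn ex)
  | right _ => None
  end.

Definition gen (S : set G) : set G :=
  smallest [set H | group_closed (fun x => x \in H)] S.

Lemma gen_group_closed (S : set G) : group_closed (fun x => x \in gen S).
Proof.
split=> [|x y]; first by rewrite inE => H [[H1 _] _]; rewrite inE in H1.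
rewrite !inE => Sx Sy H HP.
case: (HP) => [[_ Hd] _].
move: (Hd x y); rewrite !inE; apply; [exact: Sx|exact: Sy].
Qed.

Definition gen_group (S : set G) : Type := set_type (gen S).

HB.instance Definition _ S := SubChoice.on (gen_group S).
HB.instance Definition _ S := SubChoice_isSubGroup.Build
  G (fun x => x \in gen S) (gen_group S) (gen_group_closed S).

End GroupNotions.

Definition pair_iso (G : groupType) (S : set G) (H : groupType) (T : set H) :=
  exists f : {multiplicative G -> H}, bijective f /\ f @` S = T.

(* The group presented by the generators [I] and the relations [u = v] for    *)
(* [R u v], where [u] and [v] are positive words.  The elements are classes   *)
(* of signed words, [(i, false)] being the formal inverse of [(i, true)].     *)
Section Presentation.
Variables (I : Type) (R : seq I -> seq I -> Prop).

Definition positive (u : seq I) : seq (I * bool) := [seq (i, true) | i <- u].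

Inductive pres_eq : seq (I * bool) -> seq (I * bool) -> Prop :=
| pres_refl u : pres_eq u u
| pres_sym u v : pres_eq u v -> pres_eq v u
| pres_trans v u w : pres_eq u v -> pres_eq v w -> pres_eq u w
| pres_cat u u' v v' : pres_eq u u' -> pres_eq v v' -> pres_eq (u ++ v) (u' ++ v')
| pres_cancel i b : pres_eq [:: (i, b); (i, ~~ b)] [::]
| pres_rel u v : R u v -> pres_eq (positive u) (positive v).

Definition signed_word : Type := {classic seq (I * bool)}.
HB.instance Definition _ := Choice.on signed_word.

Definition pres_eqb (u v : signed_word) : bool := `[< pres_eq u v >].

Lemma pres_eqb_refl : reflexive pres_eqb.
Proof. by move=> u; apply/asboolP/pres_refl. Qed.

Lemma pres_eqb_sym : symmetric pres_eqb.
Proof. by move=> u v; apply/asboolP/asboolP => /pres_sym. Qed.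

Lemma pres_eqb_trans : transitive pres_eqb.
Proof.
by move=> v u w /asboolP uv /asboolP vw; apply/asboolP/(pres_trans uv vw).
Qed.

Canonical pres_equiv :=
  EquivRel pres_eqb pres_eqb_refl pres_eqb_sym pres_eqb_trans.

Definition pres_group : Type := {eq_quot pres_equiv}.
HB.instance Definition _ := Choice.on pres_group.
HB.instance Definition _ := EqQuotient.on pres_group.

Definition pres_class (u : seq (I * bool)) : pres_group :=
  \pi_pres_group (u : signed_word).

Lemma pres_classP u v : pres_class u = pres_class v <-> pres_eq u v.
Proof. by split=> [/eqquotP/asboolP|uv]; last exact/eqquotP/asboolP. Qed.

Lemma pres_class_ind (P : pres_group -> Prop) :
  (forall u, P (pres_class u)) -> forall x, P x.
Proof. by move=> Pu x; rewrite -[x]reprK; exact: Pu. Qed.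

Definition word_inv (u : seq (I * bool)) : seq (I * bool) :=
  rev [seq (a.1, ~~ a.2) | a <- u].

Lemma word_inv_cat u v : word_inv (u ++ v) = word_inv v ++ word_inv u.
Proof. by rewrite /word_inv map_cat rev_cat. Qed.

Lemma word_invK : involutive word_inv.
Proof.
move=> u; rewrite /word_inv map_rev revK -map_comp -[RHS]map_id.
by apply: eq_map => -[i b] /=; rewrite negbK.
Qed.

Lemma pres_eq_mulVw u : pres_eq (word_inv u ++ u) [::].
Proof.
elim: u => [|[i b] u IHu]; first exact: pres_refl.
rewrite -cat1s word_inv_cat -catA [word_inv [:: _] ++ _]catA.
apply: pres_trans IHu; apply: pres_cat; first exact: pres_refl.
rewrite -[X in pres_eq _ X]cat0s; apply: pres_cat (pres_refl _).
by have := pres_cancel i (~~ b); rewrite negbK.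
Qed.

Lemma pres_eq_mulwV u : pres_eq (u ++ word_inv u) [::].
Proof. by have := pres_eq_mulVw (word_inv u); rewrite word_invK. Qed.

Lemma pres_eq_inv u v : pres_eq u v -> pres_eq (word_inv u) (word_inv v).
Proof.
move=> uv; apply: (@pres_trans (word_inv u ++ (v ++ word_inv v))).
  rewrite -[X in pres_eq X _]cats0; apply: pres_cat; first exact: pres_refl.
  exact/pres_sym/pres_eq_mulwV.
rewrite catA -[X in pres_eq _ X]cat0s; apply: pres_cat (pres_refl _).
apply: pres_trans (pres_eq_mulVw u); apply: pres_cat; first exact: pres_refl.
exact: pres_sym.
Qed.

Definition pres_one : pres_group := pres_class [::].
Definition pres_mul (x y : pres_group) : pres_group :=
  pres_class (repr x ++ repr y).
Definition pres_inv (x : pres_group) : pres_group :=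
  pres_class (word_inv (repr x)).

Lemma pres_eq_repr u : pres_eq (repr (pres_class u)) u.
Proof. by apply/pres_classP; rewrite /pres_class reprK. Qed.

Lemma pres_mulE u v :
  pres_mul (pres_class u) (pres_class v) = pres_class (u ++ v).
Proof. by apply/pres_classP/pres_cat; exact: pres_eq_repr. Qed.

Lemma pres_invE u : pres_inv (pres_class u) = pres_class (word_inv u).
Proof. exact/pres_classP/pres_eq_inv/pres_eq_repr. Qed.

Lemma pres_mulA : associative pres_mul.
Proof.
elim/pres_class_ind=> u; elim/pres_class_ind=> v; elim/pres_class_ind=> w.
by rewrite !pres_mulE catA.
Qed.

Lemma pres_mul1 : left_id pres_one pres_mul.
Proof. by elim/pres_class_ind=> u; rewrite pres_mulE. Qed.

Lemma pres_mulr1 : right_id pres_one pres_mul.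
Proof. by elim/pres_class_ind=> u; rewrite pres_mulE cats0. Qed.

Lemma pres_mulV : left_inverse pres_one pres_inv pres_mul.
Proof.
elim/pres_class_ind=> u; rewrite pres_invE pres_mulE.
exact/pres_classP/pres_eq_mulVw.
Qed.

Lemma pres_mulrV : right_inverse pres_one pres_inv pres_mul.
Proof.
elim/pres_class_ind=> u; rewrite pres_invE pres_mulE.
exact/pres_classP/pres_eq_mulwV.
Qed.

HB.instance Definition _ := isGroup.Build pres_group
  pres_mulA pres_mul1 pres_mulr1 pres_mulV pres_mulrV.

Definition pres_gen (i : I) : pres_group := pres_class [:: (i, true)].

End Presentation.

(* [None] stands for infinity.  The groups below make sense for an arbitrary  *)
(* family [m], so that they apply to the type of a partition without first    *)
(* proving that it is a Coxeter matrix.                                       *)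
Definition coxeter_matrix (I : Type) (m : I -> I -> option nat) : Prop :=
  [/\ forall i j, m i j = m j i,
      forall i j, m i j <> Some 0%N
    & forall i j, m i j = Some 1%N <-> i = j].

Fixpoint alt (I : Type) (n : nat) (x y : I) : seq I :=
  if n is n'.+1 then x :: alt n' y x else [::].

Inductive artin_rel (I : Type) (m : I -> I -> option nat) :
    seq I -> seq I -> Prop :=
| artin_braid i j n : m i j = Some n -> artin_rel m (alt n i j) (alt n j i).

Inductive coxeter_rel (I : Type) (m : I -> I -> option nat) :
    seq I -> seq I -> Prop :=
| coxeter_square i : coxeter_rel m [:: i; i] [::]
| coxeter_braid i j n : m i j = Some n -> coxeter_rel m (alt n i j) (alt n j i).

Section Coxeter.
Variables (I : Type) (m : I -> I -> option nat).

Definition artin_group : groupType := pres_group (artin_rel m).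
Definition artin_gen (i : I) : artin_group := pres_gen (artin_rel m) i.

Definition coxeter_group : groupType := pres_group (coxeter_rel m).
Definition coxeter_gen (i : I) : coxeter_group := pres_gen (coxeter_rel m) i.

Definition spherical_matrix : Prop := finite_set [set: coxeter_group].

Definition artin_word (u : seq I) : artin_group := \prod_(i <- u) artin_gen i.
Definition coxeter_word (u : seq I) : coxeter_group :=
  \prod_(i <- u) coxeter_gen i.

Lemma coxeter_word_surj (w : coxeter_group) : exists u, coxeter_word u = w.
Proof.
elim/pres_class_ind: w => w; elim: w => [|[i b] w [u IHu]].
  by exists [::]; rewrite /coxeter_word big_nil.
exists (i :: u); rewrite /coxeter_word big_cons -/(coxeter_word u) IHu.
rewrite [LHS]pres_mulE; apply/pres_classP.
apply: (@pres_cat _ _ [:: (i, true)] [:: (i, b)] w w); last exact: pres_refl.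
case: b; first exact: pres_refl.
apply: (@pres_trans _ _ [:: (i, true); (i, true); (i, false)]).
  apply: (@pres_cat _ _ [:: (i, true)] [:: (i, true)] [::] [:: _; _]);
    first exact: pres_refl.
  exact/pres_sym/(pres_cancel _ i true).
apply: (@pres_cat _ _ [:: (i, true); (i, true)] [::] [:: (i, false)] [:: (i, false)]).
  exact: (pres_rel (coxeter_square m i)).
exact: pres_refl.
Qed.

Lemma coxeter_length_ex (w : coxeter_group) :
  exists n, `[< exists2 u, size u = n & coxeter_word u = w >].
Proof.
by have [u uw] := coxeter_word_surj w; exists (size u); apply/asboolP; exists u.
Qed.

Definition length (w : coxeter_group) : nat := ex_minn (coxeter_length_ex w).

Definition reduced_word (u : seq I) (w : coxeter_group) : Prop :=
  coxeter_word u = w /\ size u = length w.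

(* [artin_lift w] is the element of the positive monoid attached to [w],      *)
(* viewed in the Artin-Tits group; all reduced words of [w] give the same     *)
(* element, and one is chosen.                                                *)
Definition artin_lift (w : coxeter_group) : artin_group :=
  xget 1 [set b | exists2 u, reduced_word u w & b = artin_word u].

Definition parabolic (J : set I) : set coxeter_group := gen (coxeter_gen @` J).

Definition spherical (J : set I) : Prop := finite_set (parabolic J).

(* The element of maximal length of [parabolic J] for [J] spherical (it is    *)
(* then unique).                                                              *)
Definition longest (J : set I) : coxeter_group :=
  xget 1 [set r | parabolic J r /\
                  forall w, parabolic J w -> (length w <= length r)%N].

Definition ascents (w : coxeter_group) : set I :=
  [set i | length (w * coxeter_gen i) = (length w).+1].
Definition descents (w : coxeter_group) : set I :=
  [set i | (length (w * coxeter_gen i)).+1 = length w].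

Definition spherical_partition (P : set (set I)) : Prop :=
  partition P id [set: I] /\ forall J, P J -> spherical J.

Definition admissible (P : set (set I)) : Prop :=
  spherical_partition P /\
  forall w J, gen (longest @` P) w -> P J ->
    J `<=` ascents w \/ J `<=` descents w.

Definition partition_type (P : set (set I)) (a b : set_type P) : option nat :=
  order (longest (val a) * longest (val b)).

End Coxeter.

Arguments partition_type {I} m P a b.

(* Main.v *)
(* The homomorphism [psi : W_mt -> W] sending [s_a] to [r_a] preserves        *)
(* ascents: by admissibility, [a] consists of right ascents or of right       *)
(* descents of any [psi v], and a folding argument shows that the type of     *)
(* behaviour is read off [v].  Hence [psi] is injective, it preserves         *)
(* additivity of lengths, and the image [z] of the longest element of [W_mt]  *)
(* has all [s_i] as descents, so that [W] is finite with longest element [z]. *)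
(*                                                                            *)
(* Lifts of elements of [W] act by left multiplication on left-greedy normal  *)
(* forms, that is, on lists of elements of [W] ([act]); equal positive        *)
(* elements of [B_m] act in the same way up to a power of the central element *)
(* [z^2].  The action commutes with [psi], because [psi] preserves largest    *)
(* common divisors ([psi_grab]), and on the side of [mt] the product of the   *)
(* lifts recovers the acting element of [B_mt].  So positive elements of      *)
(* [B_mt] with the same image are equal, and every element of [B_mt] is       *)
(* positive up to a power of the central [z^2].                               *)

From Stdlib Require Import ZArith Reals Lra Lia.
From HB Require Import structures.
From mathcomp Require Import all_boot zify.
From mathcomp Require Import boolp classical_sets cardinality.
Require Import Defs.

Set Implicit Arguments.
Unset Strict Implicit.
Unset Printing Implicit Defensive.

Local Open Scope group_scope.
Local Open Scope classical_set_scope.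

(** * Presentations and alternating words *)

(** Admissibility makes every part behave under [psi] as a single generator does. [psi_folding] is
    [folding] with blocks in place of letters; it leads to [psi_asc] and [psi_rdesE], by which the
    descents of [v] and of [psi v] determine each other. Hence [psi] is injective, keeps lengths
    additive ([psi_ladd]) and commutes with the greedy step ([psi_grab]), so it intertwines the two
    actions on lists of simple elements ([psi_act]).

    Equality of positive words in an Artin-Tits group is tested by the action [act]. By [actM] it
    respects the braid relations. Formal inverses are handled by an element [z] having every
    generator as a descent: its square is central, and an inverse letter times that square acts as a
    positive element, so equal words act equally up to powers of [act_square] ([pres_eq_act]).
    Sphericity of the type gives such a [z] on the side of the type ([full_descents_ex]), and
    [psi z] has the same property in the group of [m] because the parts cover [I].

    Let [phi x = 1]. By [fractions], a power of the central element times [x] is a positive word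
    [u], and that power is itself a positive word [u0]. The images of [u] and [u0] are equal, hence
    act equally on the empty list up to a power of the square of [psi z]. Through [psi_act] and
    [psi_injective] this becomes an equality of lists over the group of type [mt], from which
    [act_lift] reads off [u = u0] in the Artin-Tits group, that is, [x = 1].

    The Coxeter theory used is exchange, parabolic cosets and Matsumoto's theorem, for arbitrary
    [I]. The exact orders of products of two generators come from the geometric representation for
    [m], and from [psi] for [mt]. *)

Section Alternation.
Variable T : Type.
Implicit Types x y : T.

Lemma size_alt n x y : size (alt n x y) = n.
Proof. by elim: n x y => //= n IHn x y; rewrite IHn. Qed.

Lemma map_alt U (f : T -> U) n x y :
  [seq f z | z <- alt n x y] = alt n (f x) (f y).
Proof. by elim: n x y => //= n IHn x y; rewrite IHn. Qed.

Lemma alt_rcons n x y : alt n.+1 x y = rcons (alt n x y) (if odd n then y else x).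
Proof.
elim: n x y => // n IHn x y.
by rewrite -[LHS]/(x :: alt n.+1 y x) IHn /= if_neg.
Qed.

Lemma alt_cat a b x y :
  alt (a + b) x y = alt a x y ++ (if odd a then alt b y x else alt b x y).
Proof. by elim: a x y => //= a IHa x y; rewrite IHa if_neg. Qed.

End Alternation.

Section AlternatingProducts.
Variable G : groupType.
Implicit Types x y : G.

Definition alt_prod n x y : G := \prod_(z <- alt n x y) z.

Lemma alt_prodS n x y : alt_prod n.+1 x y = x * alt_prod n y x.
Proof. by rewrite /alt_prod big_cons. Qed.

Lemma alt_prodSr n x y :
  alt_prod n.+1 x y = alt_prod n x y * (if odd n then y else x).
Proof. by rewrite /alt_prod alt_rcons big_rcons. Qed.

(** Inverting the second word reverses it, and the concatenation then alternates over [2n] letters.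
    This is how braid relations become order relations. *)
Lemma alt_prod_quot n x y : x * x = 1 -> y * y = 1 ->
  alt_prod n x y * (alt_prod n y x)^-1 = (x * y) ^+ n.
Proof.
move=> xx yy; elim: n => [|n IHn] in x y xx yy *.
  by rewrite /alt_prod !big_nil invg1 mulg1.
have yV : y^-1 = y by apply: mulg1_eq.
rewrite !alt_prodS invgM -mulgA [alt_prod n y x * _]mulgA IHn // yV.
have -> : (y * x) ^+ n * y = y * (x * y) ^+ n.
  by elim: n {IHn} => [|n IHn]; rewrite ?mul1g ?mulg1 // !expgS -!mulgA IHn.
by rewrite expgS mulgA.
Qed.

Lemma alt_prod_comm n x y : x * x = 1 -> y * y = 1 ->
  alt_prod n x y = alt_prod n y x <-> (x * y) ^+ n = 1.
Proof.
move=> xx yy; rewrite -alt_prod_quot //; split=> [->|/divg1_eq //].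
by rewrite mulgV.
Qed.

End AlternatingProducts.

Section Morphisms.
Variables (G H : groupType) (f : {multiplicative G -> H}).

Lemma mult1 : f 1 = 1.
Proof. by apply: (mulgI (f 1)); rewrite -gmulfM !mulg1. Qed.

Lemma multV x : f x^-1 = (f x)^-1.
Proof. by apply/esym/mulg1_eq; rewrite -gmulfM mulgV mult1. Qed.

Lemma mult_prod T (u : seq T) E :
  f (\prod_(i <- u) E i) = \prod_(i <- u) f (E i).
Proof. exact: (big_morph f gmulfM mult1). Qed.

End Morphisms.

(** * Actions of, and homomorphisms from, a presented group *)

Section PresentedGroups.
Variables (I : Type) (R : seq I -> seq I -> Prop).

Lemma prod_pres_gen u : \prod_(i <- u) pres_gen R i = pres_class R (positive u).
Proof.
elim: u => [|i u IHu]; first by rewrite big_nil.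
by rewrite big_cons IHu [LHS]pres_mulE.
Qed.

(** Stated on words, this spares the group of permutations of [X]. *)
Lemma pres_act X (a : I * bool -> X -> X) :
    (forall i b x, a (i, b) (a (i, ~~ b) x) = x) ->
    (forall u v x, R u v ->
       foldr a x (positive u) = foldr a x (positive v)) ->
  forall u v, pres_eq R u v -> forall x, foldr a x u = foldr a x v.
Proof.
move=> aK aR u v uv; elim: uv => {u v} [u|u v _ IH|u v w _ IH1 _ IH2
  |u u' v v' _ IH1 _ IH2|i b|u v Ruv] x //.
- by rewrite IH1.
- by rewrite !foldr_cat IH2 IH1.
- exact: aK.
- exact: aR.
Qed.

(** The universal property, read off the action of signed words on [G] by left translation,
    evaluated at 1. *)
Lemma pres_lift (G : groupType) (r : I -> G) :
    (forall u v, R u v -> \prod_(i <- u) r i = \prod_(i <- v) r i) ->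
  exists f : {multiplicative pres_group R -> G},
    forall i, f (pres_gen R i) = r i.
Proof.
move=> rR.
pose a (p : I * bool) (x : G) := (if p.2 then r p.1 else (r p.1)^-1) * x.
have aE u v x : pres_eq R u v -> foldr a x u = foldr a x v.
  move=> uv; move: u v uv x; apply: pres_act => [i [] x|u v x Ruv] /=.
  - by rewrite /a /= mulVKg.
  - by rewrite /a /= mulKg.
  have posE w : foldr a x (positive w) = \prod_(i <- w) r i * x.
    elim: w => [|i w IHw] /=; first by rewrite big_nil mul1g.
    by rewrite IHw big_cons /a /= mulgA.
  by rewrite !posE (rR _ _ Ruv).
have aM u x : foldr a x u = foldr a 1 u * x.
  by elim: u => [|p u IHu] /=; rewrite ?mul1g // IHu /a mulgA.
pose f (x : pres_group R) : G := foldr a 1 (repr x : seq (I * bool)).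
have fE u : f (pres_class R u) = foldr a 1 u by apply/aE/pres_eq_repr.
have fM : {morph f : x y / x * y}.
  elim/pres_class_ind=> u; elim/pres_class_ind=> v.
  by rewrite [_ * _]pres_mulE !fE foldr_cat aM.
pose F : {multiplicative pres_group R -> G} :=
  HB.pack f (isMultiplicative.Build _ _ f fM).
by exists F => i; rewrite [LHS]fE /= /a /= mulg1.
Qed.

End PresentedGroups.

Section CoxeterPresentation.
Variables (I : Type) (m : I -> I -> option nat).
Notation s := (coxeter_gen m).
Notation word := (coxeter_word m).

Lemma coxeter_wordE u : word u = pres_class _ (positive u).
Proof. exact: prod_pres_gen. Qed.

Lemma artin_wordE u : artin_word m u = pres_class _ (positive u).
Proof. exact: prod_pres_gen. Qed.

Lemma coxeter_word_nil : word [::] = 1.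
Proof. exact: big_nil. Qed.

Lemma coxeter_word_cons i u : word (i :: u) = s i * word u.
Proof. exact: big_cons. Qed.

Lemma coxeter_word1 i : word [:: i] = s i.
Proof. exact: big_seq1. Qed.

Lemma coxeter_word_cat u v : word (u ++ v) = word u * word v.
Proof. exact: big_cat. Qed.

Lemma coxeter_word_rcons u i : word (rcons u i) = word u * s i.
Proof. exact: big_rcons. Qed.

Lemma artin_word_cat u v : artin_word m (u ++ v) = artin_word m u * artin_word m v.
Proof. exact: big_cat. Qed.

Lemma coxeter_gen2 i : s i * s i = 1.
Proof.
rewrite -coxeter_word1 -coxeter_word_cat coxeter_wordE.
exact/pres_classP/(pres_rel (coxeter_square m i)).
Qed.

Lemma coxeter_genV i : (s i)^-1 = s i.
Proof. exact/mulg1_eq/coxeter_gen2. Qed.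

Lemma coxeter_genK i x : x * s i * s i = x.
Proof. by rewrite -mulgA coxeter_gen2 mulg1. Qed.

Lemma coxeter_genKl i x : s i * (s i * x) = x.
Proof. by rewrite mulgA coxeter_gen2 mul1g. Qed.

(* Unlike [mulgA], this leaves syntactically identical products, which [lia] *)
(* then recognises.                                                         *)
Lemma coxeter_mulA (x y z : coxeter_group m) : x * (y * z) = x * y * z.
Proof. exact: mulgA. Qed.

Lemma coxeter_word_alt n i j : word (alt n i j) = alt_prod n (s i) (s j).
Proof. by rewrite /alt_prod -map_alt big_map. Qed.

Lemma coxeter_braidE i j n :
  m i j = Some n -> word (alt n i j) = word (alt n j i).
Proof.
by move=> mij; rewrite !coxeter_wordE; exact/pres_classP/pres_rel/coxeter_braid.
Qed.

Lemma artin_braidE i j n :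
  m i j = Some n -> artin_word m (alt n i j) = artin_word m (alt n j i).
Proof.
by move=> mij; rewrite !artin_wordE; exact/pres_classP/pres_rel/artin_braid.
Qed.

Lemma coxeter_word_rev u : word (rev u) = (word u)^-1.
Proof.
elim: u => [|i u IHu]; first by rewrite coxeter_word_nil invg1.
by rewrite rev_cons coxeter_word_rcons IHu coxeter_word_cons invgM coxeter_genV.
Qed.

Lemma coxeter_act X (a : I -> X -> X) :
    (forall i, involutive (a i)) ->
    (forall i j n x, m i j = Some n ->
       foldr a x (alt n i j) = foldr a x (alt n j i)) ->
  forall u v, word u = word v -> forall x, foldr a x u = foldr a x v.
Proof.
move=> aK aB u v; rewrite !coxeter_wordE => /pres_classP uv x.
pose b (p : I * bool) := a p.1.
have bE w y : foldr b y (positive w) = foldr a y w.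
  by elim: w => //= i w ->.
rewrite -!bE; apply: pres_act uv x => [i c x|{}u {}v x]; first exact: aK.
by case=> [i|i j n mij]; rewrite !bE /= ?aK // (aB _ _ _ _ mij).
Qed.

Lemma coxeter_lift (G : groupType) (r : I -> G) :
    (forall i, r i * r i = 1) ->
    (forall i j n, m i j = Some n -> (r i * r j) ^+ n = 1) ->
  exists f : {multiplicative coxeter_group m -> G}, forall i, f (s i) = r i.
Proof.
move=> rr rB; apply: pres_lift => u v [i|i j n mij].
  by rewrite big_cons big_seq1 big_nil.
have E k l : \prod_(z <- alt n k l) r z = alt_prod n (r k) (r l).
  by rewrite /alt_prod -map_alt big_map.
by rewrite !E; apply/alt_prod_comm; [exact: rr|exact: rr|exact: rB].
Qed.

End CoxeterPresentation.

Lemma alt_rev T n (x y : T) :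
  rev (alt n x y) = if odd n then alt n x y else alt n y x.
Proof.
elim: n x y => // n IHn x y.
rewrite -[alt n.+1 x y in LHS]/(x :: alt n y x) rev_cons IHn.
by rewrite oddS; case: ifPn => on; rewrite [RHS]alt_rcons ?on ?(negPf on).
Qed.

Lemma alt_prod_double (G : groupType) n (x y : G) :
  alt_prod n.*2 x y = (x * y) ^+ n.
Proof.
elim: n => [|n IHn]; first by rewrite /alt_prod big_nil.
by rewrite doubleS !alt_prodS IHn expgS mulgA.
Qed.

(** * The order of a product of two generators *)

Section GeometricRepresentation.
Local Open Scope R_scope.
Variables (I : Type) (m : I -> I -> option nat).
Hypothesis hm : coxeter_matrix m.

(** This is [- 2 B(alpha_i, alpha_j)] for the Tits form [B], whose value is [- cos (PI / m i j)],
    and -1 when [m i j] is infinite. *)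
Definition edge_weight i j : R := if m i j is Some n then 2 * cos (PI / INR n) else 2.

(* The contragredient of the geometric representation: the value at [j] is    *)
(* the pairing with the simple root [alpha_j], so an infinite [I] is harmless.*)
Definition fire i (f : I -> R) : I -> R := fun j => f j + edge_weight i j * f i.

Lemma edge_weightC i j : edge_weight i j = edge_weight j i.
Proof. by case: hm => mC _ _; rewrite /edge_weight mC. Qed.

Lemma edge_weight_diag i : edge_weight i i = - 2.
Proof.
case: hm => _ _ m1; rewrite /edge_weight (_ : m i i = Some 1%N); last exact/m1.
by rewrite /= Rdiv_1_r cos_PI; ring.
Qed.

Lemma fireK i : involutive (fire i).
Proof.
by move=> f; apply/funext => j; rewrite /fire edge_weight_diag; ring.
Qed.

(** * Orbits under two alternating reflections *)

Section Dihedral.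
Variables i j : I.
Let c := edge_weight i j.
Definition fires k f := foldr fire f (rev (alt k i j)).

Lemma firesS k f : fires k.+1 f = fire (if odd k then j else i) (fires k f).
Proof. by rewrite /fires alt_rcons rev_rcons. Qed.

(* The values at the node about to be fired and at the other one. *)
Definition fires_next k f := fires k f (if odd k then j else i).
Definition fires_last k f := fires k f (if odd k then i else j).

Lemma fires_nextS k f : fires_next k.+1 f = fires_last k f + c * fires_next k f.
Proof.
rewrite /fires_next /fires_last firesS /= /fire; case: (odd k) => //=.
by rewrite edge_weightC.
Qed.

Lemma fires_lastS k f : fires_last k.+1 f = - fires_next k f.
Proof.
rewrite /fires_next /fires_last firesS /= /fire.
by case: (odd k) => /=; rewrite edge_weight_diag; ring.
Qed.

(** The values satisfy the recursion [x_(k+1) = c x_k - x_(k-1)], which sines solve when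
    [c = 2 cos t]. *)
Lemma fires_sin t k f : c = 2 * cos t ->
  sin t * fires_next k f = sin ((INR k + 1) * t) * f i + sin (INR k * t) * f j /\
  sin t * fires_last k f = - (sin (INR k * t) * f i + sin ((INR k - 1) * t) * f j).
Proof.
move=> cE; elim: k => [|k [IHp IHq]].
  rewrite /fires_next /fires_last /= Rplus_0_l Rmult_1_l Rmult_0_l sin_0.
  rewrite (_ : (0 - 1) * t = - t); last by ring.
  by rewrite sin_neg /fires /=; split; ring.
rewrite fires_nextS fires_lastS S_INR; split; last first.
  rewrite (_ : (INR k + 1 - 1) * t = INR k * t); last by ring.
  by rewrite -[LHS]/(sin t * (- _)) -Ropp_mult_distr_r IHp.
rewrite cE Rmult_plus_distr_l IHq.
have -> : sin t * (2 * cos t * fires_next k f) = 2 * cos t * (sin t * fires_next k f) by ring.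
rewrite IHp.
have sinS x : sin ((x + 1) * t) = 2 * cos t * sin (x * t) - sin ((x - 1) * t).
  rewrite (_ : (x + 1) * t = x * t + t); last by ring.
  rewrite (_ : (x - 1) * t = x * t - t); last by ring.
  by rewrite sin_plus sin_minus; ring.
rewrite (sinS (INR k + 1)) (sinS (INR k)).
rewrite (_ : INR k + 1 - 1 = INR k); last by ring.
by ring.
Qed.

Lemma fires_unipotent k f : c = 2 ->
  fires_next k f = f i + INR k * (f i + f j) /\
  fires_last k f = f j - INR k * (f i + f j).
Proof.
move=> cE; elim: k => [|k [IHp IHq]].
  by rewrite /fires_next /fires_last /fires /=; split; ring.
by rewrite fires_nextS fires_lastS S_INR cE IHp IHq; split; ring.
Qed.

(** The two equations say that [alpha_l + x alpha_i + y alpha_j] is orthogonal to [alpha_i] and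
    [alpha_j], hence fixed by both reflections. *)
Lemma fires_invariant l k f x y :
    2 * x = edge_weight i l + c * y -> 2 * y = edge_weight j l + c * x ->
  fires k f l + x * fires k f i + y * fires k f j = f l + x * f i + y * f j.
Proof.
move=> xE yE; elim: k => [|k <-]; first by [].
rewrite firesS /fire; case: (odd k); rewrite edge_weight_diag.
  rewrite (edge_weightC j i) -/c.
  have -> : edge_weight j l = 2 * y - c * x by rewrite yE; ring.
  by ring.
have -> : edge_weight i l = 2 * x - c * y by rewrite xE; ring.
by rewrite -/c; ring.
Qed.

End Dihedral.

Lemma pi_div_bounds n : (1 < n)%N -> 0 < PI / INR n < PI.
Proof.
move=> n_gt1; have n1 : 1 < INR n by apply: (lt_INR 1); apply/ltP.
have := PI_RGT_0 => pi0; split; first by apply: Rdiv_lt_0_compat; lra.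
apply: (Rmult_lt_reg_r (INR n)); first by lra.
rewrite (_ : PI / INR n * INR n = PI); last by field; lra.
by nra.
Qed.

(** The longest element of a finite dihedral group sends the simple roots to negatives of simple
    roots. *)
Lemma fires_full i j n f : m i j = Some n -> (1 < n)%N ->
  fires_next i j n f = - f i /\ fires_last i j n f = - f j.
Proof.
move=> mij n_gt1; have [t0 t1] := pi_div_bounds n_gt1.
set t := PI / INR n in t0 t1; have st := sin_gt_0 t t0 t1.
have cE : edge_weight i j = 2 * cos t by rewrite /edge_weight mij.
have n1 : 1 < INR n by apply: (lt_INR 1); apply/ltP.
have tn : INR n * t = PI by rewrite /t; field; lra.
have [pE qE] := fires_sin n f cE; move: pE qE.
rewrite (_ : (INR n + 1) * t = t + PI); last by rewrite -tn; ring.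
rewrite (_ : (INR n - 1) * t = PI - t); last by rewrite -tn; ring.
rewrite neg_sin sin_PI_x tn sin_PI => pE qE.
by split; apply: (Rmult_eq_reg_l (sin t)); lra.
Qed.

(** At [i] and [j] the values are known from [fires_full]. They determine the value at any [l]
    through [fires_invariant], since the form is nondegenerate on the plane of [alpha_i] and
    [alpha_j]. *)
Lemma fire_braid i j n f : m i j = Some n ->
  foldr fire f (alt n i j) = foldr fire f (alt n j i).
Proof.
move=> mij; have [mC m0 m1] := hm.
have [n_gt1|] := ltnP 1 n; last first.
  by case: n mij => [/m0 //|[/m1-> //|//]].
suff E : fires i j n f = fires j i n f.
  by move: E; rewrite /fires !alt_rev; case: ifP.
have mji : m j i = Some n by rewrite mC.
have [] := fires_full f mij n_gt1; have [] := fires_full f mji n_gt1.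
have [t0 t1] := pi_div_bounds n_gt1.
have st := sin_gt_0 _ t0 t1.
have cE : edge_weight i j = 2 * cos (PI / INR n) by rewrite /edge_weight mij.
set t := PI / INR n in st cE; have sc := sin2_cos2 t; rewrite /Rsqr in sc.
have d0 : 4 - edge_weight i j * edge_weight i j <> 0 by rewrite cE; nra.
rewrite /fires_next /fires_last => j1 j2 i1 i2.
have [Ei Ej] : fires i j n f i = fires j i n f i /\ fires i j n f j = fires j i n f j.
  by move: j1 j2 i1 i2; case: (odd n) => -> -> -> ->.
apply/funext => l; set c := edge_weight i j in d0.
pose x := (2 * edge_weight i l + c * edge_weight j l) / (4 - c * c).
pose y := (2 * edge_weight j l + c * edge_weight i l) / (4 - c * c).
have xE : 2 * x = edge_weight i l + c * y by rewrite /x /y; field.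
have yE : 2 * y = edge_weight j l + c * x by rewrite /x /y; field.
have := fires_invariant n f xE yE.
have := @fires_invariant j i l n f y x.
rewrite (edge_weightC j i) -/c => /(_ yE xE); rewrite Ei Ej; lra.
Qed.

(** In the geometric representation, for [i <> j], the product of the two reflections is unipotent
    of infinite order when [m i j] is infinite, and otherwise a rotation of angle [2 PI / k]. *)
Lemma coxeter_gen_order i j n : (0 < n)%N ->
  ((coxeter_gen m i * coxeter_gen m j) ^+ n = 1)%g ->
  exists2 k, m i j = Some k & (k %| n)%N.
Proof.
move=> n_gt0 sn; have [mC m0 m1] := hm.
have [ij|ij] := pselect (i = j); first by exists 1%N => //; apply/m1.
(* The functional that is 1 on [alpha_i] and 0 on the other simple roots detects the angle. *)
pose f l : R := if pselect (l = i) then 1 else 0.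
have fi : f i = 1 by rewrite /f; case: pselect.
have fj : f j = 0 by rewrite /f; case: pselect => // ji; case: ij.
have fE : fires i j n.*2 f = f.
  rewrite /fires -[RHS]/(foldr fire f [::]); apply: (@coxeter_act _ m).
  - exact: fireK.
  - by move=> *; exact: fire_braid.
  rewrite coxeter_word_rev coxeter_word_nil coxeter_word_alt alt_prod_double sn.
  exact: invg1.
have pE : fires_next i j n.*2 f = 1 by rewrite /fires_next odd_double fE.
have qE : fires_last i j n.*2 f = 0 by rewrite /fires_last odd_double fE.
case mij: (m i j) => [k|]; last first.
  have cE : edge_weight i j = 2 by rewrite /edge_weight mij.
  have [_] := fires_unipotent n.*2 f cE; rewrite qE fi fj => E0.
  have : 0 < INR n.*2 by apply: (lt_INR 0); apply/ltP; rewrite double_gt0.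
  by lra.
exists k => //; have k_gt1 : (1 < k)%N.
  by case: k mij => [/m0 //|[/m1 //|//]].
have [t0 t1] := pi_div_bounds k_gt1.
have st := sin_gt_0 _ t0 t1.
have cE : edge_weight i j = 2 * cos (PI / INR k) by rewrite /edge_weight mij.
have [] := fires_sin n.*2 f cE; rewrite pE qE fi fj.
set t := PI / INR k in st cE *.
have -> : (INR n.*2 + 1) * t = INR n.*2 * t + t by ring.
rewrite sin_plus => E1 E2.
have s0 : sin (INR n.*2 * t) = 0 by lra.
have c1 : cos (INR n.*2 * t) = 1.
  by apply: (Rmult_eq_reg_r (sin t)); [rewrite s0 in E1; lra|lra].
have nE : INR n.*2 * t = 2 * (INR n * t).
  by rewrite -addnn plus_INR; ring.
have sn0 : sin (INR n * t) = 0.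
  move: c1; rewrite nE cos_2a_sin => c1; apply: Rsqr_0_uniq.
  by rewrite /Rsqr; lra.
have [z zE] := sin_eq_0_0 _ sn0.
have k1 : 1 < INR k by apply: (lt_INR 1); apply/ltP.
have := PI_RGT_0 => pi0.
have {}zE : INR n = IZR z * INR k.
  apply: (Rmult_eq_reg_r (PI / INR k)); last by lra.
  by rewrite -/t zE /t; field; lra.
have : Z.of_nat n = Z.mul z (Z.of_nat k).
  by apply: eq_IZR; rewrite mult_IZR -!INR_IZR_INZ.
move=> nzk; apply/dvdnP; exists (Z.to_nat z); apply/Nat2Z.inj.
rewrite -multE Nat2Z.inj_mul Z2Nat.id //.
have : (0 < IZR z * INR k) by rewrite -zE; apply: (lt_INR 0); apply/ltP.
move=> zk; apply: le_IZR; nra.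
Qed.

End GeometricRepresentation.

(** * The exchange condition *)

Section CoxeterSystems.
Variables (I : Type) (m : I -> I -> option nat).
Notation W := (coxeter_group m).
Notation s := (coxeter_gen m).
Notation word := (coxeter_word m).
Implicit Types (i j : I) (u v : seq I) (w x y z t : W) (J : set I).

Section Length.

Lemma length_word u : (length (word u) <= size u)%N.
Proof.
rewrite /length; case: ex_minnP => n _; apply.
by apply/asboolP; exists u.
Qed.

Lemma reduced_word_ex w : exists u, reduced_word u w.
Proof.
by rewrite /reduced_word /length; case: ex_minnP => n /asboolP[u un uw] _; exists u.
Qed.

Lemma length1 : length (1 : W) = 0%N.
Proof. by apply/eqP; rewrite -leqn0 -coxeter_word_nil; exact: length_word. Qed.

Lemma length_eq0 w : length w = 0%N -> w = 1.
Proof.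
have [u [<- <-]] := reduced_word_ex w => /size0nil ->.
exact: coxeter_word_nil.
Qed.

Lemma lengthM x y : (length (x * y) <= length x + length y)%N.
Proof.
have [u [<- <-]] := reduced_word_ex x; have [v [<- <-]] := reduced_word_ex y.
by rewrite -coxeter_word_cat -size_cat; exact: length_word.
Qed.

Lemma lengthV x : length x^-1 = length x.
Proof.
have le y : (length y^-1 <= length y)%N.
  have [u [<- <-]] := reduced_word_ex y.
  by rewrite -coxeter_word_rev -(size_rev u); exact: length_word.
by apply/eqP; rewrite eqn_leq le -{1}[x]invgK le.
Qed.

End Length.

Definition reflect_by i (p : W * bool) : W * bool :=
  (s i * p.1 * s i, p.2 (+) (p.1 == s i)).

Lemma conj_gen_eq i t : (s i * t * s i == s i) = (t == s i).
Proof.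
apply/eqP/eqP => [E|->]; last by rewrite coxeter_genK.
by rewrite -[t](coxeter_genKl i) -[s i * t](coxeter_genK i) E coxeter_gen2 mulg1.
Qed.

Lemma reflect_byK i : involutive (reflect_by i).
Proof.
case=> t e; rewrite /reflect_by /= conj_gen_eq -addbA addbb addbF.
by rewrite -!mulgA coxeter_gen2 mulg1 coxeter_genKl.
Qed.

(* Parity of the number of occurrences of [t] among the reflections of the    *)
(* word [u]; it depends on [word u] only (Bourbaki's sign cocycle).           *)
Definition inversion u t : bool := (foldr reflect_by (t, false) u).2.

Lemma foldr_reflect_by u t e :
  foldr reflect_by (t, e) u = (word u * t * (word u)^-1, e (+) inversion u t).
Proof.
elim: u e => [|i u IHu] e.
  by rewrite coxeter_word_nil invg1 mul1g mulg1 addbF.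
rewrite /= /inversion /= -/(foldr reflect_by) !IHu /reflect_by /=.
by rewrite coxeter_word_cons invgM coxeter_genV !mulgA addbA.
Qed.

Lemma inversion_cons i u t : inversion (i :: u) t =
  inversion u t (+) (word u * t * (word u)^-1 == s i).
Proof. by rewrite /inversion /= foldr_reflect_by. Qed.

Lemma inversion_cat u v t : inversion (u ++ v) t =
  inversion v t (+) inversion u (word v * t * (word v)^-1).
Proof. by rewrite {1}/inversion foldr_cat !foldr_reflect_by. Qed.

(** After reversal a longer word extends a shorter one on the left, so each step adds a single
    reflection. *)
Lemma inversion_rev_alt n i j t : inversion (rev (alt n i j)) t =
  \big[addb/false]_(k < n) (t == (s i * s j) ^+ k * s i).
Proof.
elim: n => [|n IHn]; first by rewrite big_ord0.
rewrite alt_rcons rev_rcons inversion_cons IHn big_ord_recr /=; congr (_ (+) _).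
rewrite coxeter_word_rev invgK coxeter_word_alt.
set a := alt_prod _ _ _; set l := if _ then _ else _.
have <- : a * s l * a^-1 = (s i * s j) ^+ n * s i.
  have := alt_prod_quot n.+1 (coxeter_gen2 m i) (coxeter_gen2 m j).
  rewrite alt_prodSr -(fun_if s) -/l -/a alt_prodS -/a.
  rewrite invgM coxeter_genV expgSr => /(congr1 (fun x => x * s j)).
  by rewrite !mulgA !coxeter_genK /l; case: (odd n).
apply/eqP/eqP => [<-|->].
  by rewrite !mulgA mulgV mul1g -mulgA mulgV mulg1.
by rewrite !mulgA mulVg mul1g -mulgA mulVg mulg1.
Qed.

(** Since [(s i * s j) ^+ n = 1], the two sides list the same dihedral reflections in opposite
    orders. *)
Lemma inversion_braid n i j t : m i j = Some n ->
  inversion (rev (alt n i j)) t = inversion (rev (alt n j i)) t.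
Proof.
move=> mij; rewrite !inversion_rev_alt (reindex_inj rev_ord_inj) /=.
apply: eq_bigr => k _; congr (_ == _).
have sn : (s i * s j) ^+ n = 1.
  apply/alt_prod_comm; rewrite ?coxeter_gen2 // -!coxeter_word_alt.
  exact: coxeter_braidE.
have -> : (s i * s j) ^+ (n - k.+1) = (s j * s i) ^+ k.+1.
  have <- : ((s i * s j) ^+ k.+1)^-1 = (s j * s i) ^+ k.+1.
    by rewrite -expVgn invgM !coxeter_genV.
  by apply/esym/mulg1_eq; rewrite -expgnDr subnKC.
by rewrite expgSr !mulgA coxeter_genK.
Qed.

Lemma inversionE u v t : word u = word v -> inversion u t = inversion v t.
Proof.
move=> uv; rewrite /inversion; congr (_.2); move: u v uv (t, false).
apply: coxeter_act => [|i j n [t0 e] mij]; first exact: reflect_byK.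
have E : foldr reflect_by (t0, e) (rev (alt n i j))
       = foldr reflect_by (t0, e) (rev (alt n j i)).
  rewrite !foldr_reflect_by (inversion_braid _ mij) !coxeter_word_rev.
  by rewrite (coxeter_braidE mij).
by move: E; rewrite !alt_rev; case: ifP.
Qed.

(** Multiplying by the reflection attached to a letter deletes that letter. *)
Lemma inversion_deletion u t : inversion u t ->
  exists u1 i u2, u = u1 ++ i :: u2 /\ word u * t = word (u1 ++ u2).
Proof.
elim: u => [//|i u IHu]; rewrite inversion_cons.
have [ut _|_ /eqP ti] := boolP (inversion u t).
  have [u1 [j [u2 [-> E]]]] := IHu ut; exists (i :: u1), j, u2; split=> //.
  by rewrite coxeter_word_cons -mulgA E coxeter_word_cons.
exists [::], i, u; split=> //; have E : word u * t = s i * word u.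
  by rewrite -ti -mulgA mulVg mulg1.
by rewrite coxeter_word_cons -mulgA E coxeter_genKl.
Qed.

Lemma inversion_length u t : inversion u t -> (length (word u * t) < length (word u))%N.
Proof.
have [v [vu sz]] := reduced_word_ex (word u).
rewrite -(inversionE t vu) -sz -vu => /inversion_deletion[u1 [i [u2 [-> ->]]]].
rewrite size_cat /= addnS ltnS -size_cat; exact: length_word.
Qed.

Definition rdes w i : bool := (length (w * s i) < length w)%N.

(** Appending [i] flips the cocycle at [s i], and wherever it is true the length drops. So exactly
    one of [word u] and [word (rcons u i)] has [i] as a descent. *)
Lemma rdesE u i : rdes (word u) i = inversion u (s i).
Proof.
apply/idP/idP => [|/inversion_length//]; apply: contraLR => ui.
have : inversion (rcons u i) (s i).
  rewrite -cats1 inversion_cat inversion_cons coxeter_word_nil coxeter_word1.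
  by rewrite invg1 mul1g mulg1 eqxx mulgK (negPf ui).
move=> /inversion_length; rewrite coxeter_word_rcons coxeter_genK.
by rewrite /rdes -leqNgt; exact: ltnW.
Qed.

Lemma rdesN w i : rdes (w * s i) i = ~~ rdes w i.
Proof.
have [u [<- _]] := reduced_word_ex w.
rewrite -coxeter_word_rcons !rdesE -cats1 inversion_cat inversion_cons.
by rewrite coxeter_word_nil coxeter_word1 invg1 mul1g mulg1 eqxx mulgK.
Qed.

Lemma length_asc w i : ~~ rdes w i -> length (w * s i) = (length w).+1.
Proof.
rewrite -rdesN /rdes coxeter_genK => lt; apply/eqP; rewrite eqn_leq lt andbT.
rewrite -addn1 (leq_trans (lengthM _ _)) // leq_add2l.
by rewrite -coxeter_word1 (leq_trans (length_word _)).
Qed.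

Lemma length_des w i : rdes w i -> (length (w * s i)).+1 = length w.
Proof.
by rewrite -[rdes w i]negbK -rdesN => /length_asc; rewrite coxeter_genK.
Qed.

Lemma rdes1 i : rdes 1 i = false.
Proof. by rewrite /rdes length1. Qed.

Lemma length_gen i : length (s i) = 1%N.
Proof.
by have := @length_asc 1 i; rewrite rdes1 mul1g length1 => ->.
Qed.

Lemma rdes_neq1 w : w <> 1 -> exists i, rdes w i.
Proof.
have [u [<- sz]] := reduced_word_ex w; case/lastP: u sz => [|u i] sz.
  by rewrite coxeter_word_nil.
move=> _; exists i; rewrite /rdes -sz coxeter_word_rcons coxeter_genK size_rcons.
exact: length_word.
Qed.

Lemma exchange u i : rdes (word u) i ->
  exists u1 j u2, u = u1 ++ j :: u2 /\ word u * s i = word (u1 ++ u2).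
Proof. by rewrite rdesE; exact: inversion_deletion. Qed.

(** The exchanged letter must be the leading [g]: any other deletion would write [y * s i] with
    fewer letters than its length. *)
Lemma folding g y i : ~~ rdes y i -> rdes (s g * y) i -> s g * y = y * s i.
Proof.
have [u [<- sz]] := reduced_word_ex y => asc.
rewrite -coxeter_word_cons => /exchange[[|h u1] [j [u2 [[-> E0]]]]].
  move: E0; rewrite coxeter_word_cons /= => uE E.
  by rewrite -[LHS](coxeter_genK i) E uE.
rewrite cat_cons !coxeter_word_cons -mulgA => /mulgI E.
have := length_asc asc; rewrite E => lE.
have := length_word (u1 ++ u2); by rewrite lE -sz E0 !size_cat /= addnS ltnNge leqnSn.
Qed.

End CoxeterSystems.

(** * Parabolic cosets *)

Lemma cat_eq_cat_cons T (s1 s2 t1 t2 : seq T) x : s1 ++ s2 = t1 ++ x :: t2 ->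
  (exists r, s1 = t1 ++ x :: r /\ t2 = r ++ s2) \/
  (exists r, t1 = s1 ++ r /\ s2 = r ++ x :: t2).
Proof.
elim: s1 t1 => [|a s1 IHs] [|b t1] /=.
- by move=> ->; right; exists [::].
- by move=> ->; right; exists (b :: t1).
- by case=> -> <-; left; exists s1.
case=> -> /IHs[[r [-> ->]]|[r [-> ->]]]; first by left; exists r.
by right; exists r.
Qed.

Section Parabolic.
Variables (I : Type) (m : I -> I -> option nat).
Notation W := (coxeter_group m).
Notation s := (coxeter_gen m).
Notation word := (coxeter_word m).
Implicit Types (i j : I) (u v : seq I) (w x y z t : W) (J : set I).

Definition ladd x y : bool := length (x * y) == (length x + length y)%N.

Lemma ladd3 x y z : ladd x (y * z) && ladd y z =
  (length (x * y * z) == (length x + length y + length z)%N).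
Proof.
rewrite /ladd -coxeter_mulA; apply/andP/eqP => [[/eqP-> /eqP->]|E]; first by lia.
have := lengthM x (y * z); have := lengthM y z.
by split; apply/eqP; lia.
Qed.

Lemma laddA x y z : ladd x (y * z) && ladd y z = ladd x y && ladd (x * y) z.
Proof.
rewrite ladd3 /ladd; apply/eqP/andP => [E|[/eqP<- /eqP->] //].
by have := lengthM x y; have := lengthM (x * y) z; split; apply/eqP; lia.
Qed.

Lemma laddAl x y z : ladd x (y * z) -> ladd y z -> ladd x y /\ ladd (x * y) z.
Proof. by move=> a b; apply/andP; rewrite -laddA a. Qed.

Lemma laddAr x y z : ladd x y -> ladd (x * y) z -> ladd x (y * z) /\ ladd y z.
Proof. by move=> a b; apply/andP; rewrite laddA a. Qed.

Lemma ladd1l x : ladd 1 x.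
Proof. by rewrite /ladd mul1g length1. Qed.

Lemma ladd1r x : ladd x 1.
Proof. by rewrite /ladd mulg1 length1 addn0. Qed.

Lemma laddV x y : ladd x y = ladd y^-1 x^-1.
Proof. by rewrite /ladd -invgM !lengthV addnC. Qed.

Lemma ladd_gen w i : ladd w (s i) = ~~ rdes w i.
Proof.
rewrite /ladd length_gen addn1; have [des|asc] := boolP (rdes w i).
  by have := length_des des => E; apply/negbTE/eqP; lia.
by rewrite length_asc ?eqxx.
Qed.

Definition J_word J u := all (fun i => i \in J) u.
Definition J_min J w := forall i, J i -> ~~ rdes w i.

Lemma J_word_rcons J u i : J_word J (rcons u i) <-> J i /\ J_word J u.
Proof. by rewrite /J_word all_rcons; split=> [/andP[/set_mem]|[/mem_set-> ->]]. Qed.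

Lemma J_word_cat J u v : J_word J (u ++ v) = J_word J u && J_word J v.
Proof. exact: all_cat. Qed.

Lemma J_word_rev J u : J_word J (rev u) = J_word J u.
Proof. exact: all_rev. Qed.

Lemma J_word_minimal J u : J_word J u -> exists2 v, J_word J v /\ word v = word u &
  forall v', J_word J v' -> word v' = word u -> (size v <= size v')%N.
Proof.
move=> Ju; pose P n := `[< exists2 v, J_word J v /\ word v = word u & size v = n >].
have exP : exists n, P n by exists (size u); apply/asboolP; exists u.
case: (ex_minnP exP) => n /asboolP[v Pv <-] nmin; exists v => // v' Jv' v'u.
by apply: nmin; apply/asboolP; exists v'.
Qed.

(** If a letter of [u] shortened the product, exchange would delete a letter either of [y], giving a
    shorter element of the coset, or of [u], giving a shorter [J]-word. *)
Lemma coset_minimal_add J y u :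
    (forall v, J_word J v -> length y <= length (y * word v))%N -> J_word J u ->
    (forall v, J_word J v -> word v = word u -> size u <= size v)%N ->
  length (y * word u) = (length y + size u)%N.
Proof.
move=> ymin; elim/last_ind: u => [|u i IHu].
  by rewrite coxeter_word_nil mulg1 addn0.
move=> /J_word_rcons[Ji Ju] umin.
have {}IHu : length (y * word u) = (length y + size u)%N.
  apply: IHu => // v Jv vu; have := umin (rcons v i).
  rewrite !size_rcons !coxeter_word_rcons vu ltnS; apply=> //.
  by apply/J_word_rcons.
rewrite coxeter_word_rcons coxeter_mulA size_rcons addnS.
have [des|asc] := boolP (rdes (y * word u) i); last by rewrite length_asc // IHu.
have [v [vy sv]] := reduced_word_ex y.
move: des; rewrite -vy -coxeter_word_cat => des.
have [u1 [j [u2 [uv E]]]] := exchange des.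
have [[r [vE rE]]|[r [rE uE]]] := cat_eq_cat_cons uv; rewrite rE in E; exfalso.
  have := ymin (u ++ i :: rev u).
  rewrite J_word_cat Ju /= J_word_rev Ju mem_set // => /(_ isT).
  have -> : y * word (u ++ i :: rev u) = word (u1 ++ r).
    rewrite -vy coxeter_word_cat coxeter_word_cons coxeter_word_rev.
    by rewrite !coxeter_mulA -coxeter_word_cat E catA coxeter_word_cat mulgK.
  have := length_word m (u1 ++ r); rewrite -sv vE !size_cat /=; lia.
have := umin (r ++ u2); rewrite coxeter_word_rcons.
have -> : word u * s i = word (r ++ u2).
  apply: (mulgI (word v)); rewrite coxeter_mulA -!coxeter_word_cat E.
  by rewrite -catA.
move: Ju; rewrite uE J_word_cat /= J_word_cat => /and3P[-> _ ->] /(_ isT erefl).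
by rewrite size_rcons !size_cat /=; lia.
Qed.

(** Starting from a shortest element of the coset, [y] is reached by a length-additive product with
    a [J]-word; if that word were not empty, its last letter would be a descent of [y]. *)
Lemma J_min_coset J y u : J_min J y -> J_word J u ->
  (length y <= length (y * word u))%N.
Proof.
move=> yJ; move: u.
pose P n := `[< exists2 v, J_word J v & length (y * word v) = n >].
have exP : exists n, P n by exists (length (y * word [::])); apply/asboolP; exists [::].
case: (ex_minnP exP) => n /asboolP[v Jv vn] nmin u Ju.
have {}nmin v' : J_word J v' -> (n <= length (y * word v'))%N.
  by move=> Jv'; apply: nmin; apply/asboolP; exists v'.
suff -> : length y = n by exact: nmin.
have Jr : J_word J (rev v) by rewrite J_word_rev.
have [v' [Jv' v'E] v'min] := J_word_minimal Jr.
have : length (y * word v * word v') = (length (y * word v) + size v')%N.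
  apply: (@coset_minimal_add J) => // [v2 Jv2|v2 Jv2 v2E].
    by rewrite vn -coxeter_mulA -coxeter_word_cat nmin // J_word_cat Jv.
  by apply: v'min => //; rewrite v2E.
rewrite v'E coxeter_word_rev mulgK vn.
case/lastP: v' => [|v' i] in Jv' v'E v'min * => [|E]; first by rewrite addn0.
exfalso; move/J_word_rcons: Jv' => [/yJ asc Jv'].
have yE : y * s i = y * word v * word v'.
  rewrite -[RHS](coxeter_genK i) -(coxeter_mulA _ (word v')).
  by rewrite -coxeter_word_rcons v'E coxeter_word_rev mulgK.
have := lengthM (y * word v) (word v'); have := length_word m v'.
rewrite -yE length_asc // E vn size_rcons; lia.
Qed.

Lemma J_min_add J y u : J_min J y -> J_word J u -> size u = length (word u) ->
  length (y * word u) = (length y + size u)%N.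
Proof.
move=> yJ Ju sz; apply: (@coset_minimal_add J) => // [v Jv|v Jv E].
  exact: J_min_coset yJ Jv.
by rewrite sz -E length_word.
Qed.

Lemma J_word_reduced J u : J_word J u ->
  exists v, [/\ J_word J v, word v = word u & size v = length (word u)].
Proof.
move=> Ju; have [v [Jv vu] vmin] := J_word_minimal Ju; exists v; split=> //.
rewrite -vu -[word v]mul1g (@coset_minimal_add J) ?length1 // => v' Jv' E.
by apply: vmin; rewrite // E.
Qed.

Lemma J_decompose J w : exists y u,
  [/\ w = y * word u, J_min J y, J_word J u & length w = (length y + size u)%N].
Proof.
have [n] := ubnP (length w); elim: n w => // n IHn w.
have [wJ _|] := pselect (J_min J w).
  by exists w, [::]; rewrite coxeter_word_nil mulg1 addn0.
move=> /existsNP[i /not_implyP[Ji /negP/negPn des]] wn.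
have [|y [u [wE yJ Ju wl]]] := IHn (w * s i); first by have := length_des des; lia.
exists y, (rcons u i); split=> //.
- by rewrite coxeter_word_rcons coxeter_mulA -wE coxeter_genK.
- exact/J_word_rcons.
by rewrite size_rcons; have := length_des des; lia.
Qed.

Lemma J_decompose_des J y u i : J_min J y -> J_word J u ->
    length (y * word u) = (length y + size u)%N -> J i ->
  rdes (y * word u) i -> rdes (word u) i.
Proof.
move=> yJ Ju l Ji; apply: contraLR => asc.
have sz : size u = length (word u).
  by have := lengthM y (word u); have := length_word m u; lia.
have := @J_min_add J y (rcons u i) yJ; rewrite J_word_rcons coxeter_word_rcons.
rewrite size_rcons length_asc // sz coxeter_mulA => /(_ (conj Ji Ju) erefl) E.
by rewrite /rdes E l -leqNgt; lia.
Qed.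

End Parabolic.

(** * Two descents and Matsumoto's theorem *)

Section Matsumoto.
Variables (I : Type) (m : I -> I -> option nat).
Hypothesis hm : coxeter_matrix m.
Hypothesis hord : forall i j n, (0 < n)%N ->
  (coxeter_gen m i * coxeter_gen m j) ^+ n = 1 ->
  exists2 k, m i j = Some k & (k %| n)%N.
Notation W := (coxeter_group m).
Notation s := (coxeter_gen m).
Notation word := (coxeter_word m).
Notation lift := (@artin_lift I m).
Implicit Types (i j : I) (u v : seq I) (w x y z t : W) (J : set I).

(* The alternating product of [k] generators among [s_i], [s_j] that ends in  *)
(* [s_j].                                                                     *)
Definition alt_end k i j : W := word (rev (alt k j i)).

Lemma alt_endS k i j :
  alt_end k.+1 i j = s (if odd k then i else j) * alt_end k i j.
Proof. by rewrite /alt_end alt_rcons rev_rcons coxeter_word_cons. Qed.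

Lemma length_alt_end k i j : (length (alt_end k i j) <= k)%N.
Proof. by rewrite (leq_trans (length_word _ _)) // size_rev size_alt. Qed.

(** A first descent would, by [folding], equate the two alternating products of length [k.+1], which
    is an order relation. *)
Lemma alt_end_asc k i j :
    (forall n, (0 < n <= k)%N -> (s j * s i) ^+ n <> 1) ->
  ~~ rdes (alt_end k i j) i.
Proof.
elim: k => [|k IHk] ord; first by rewrite /alt_end coxeter_word_nil rdes1.
have {}IHk : ~~ rdes (alt_end k i j) i.
  by apply: IHk => n nk; apply: ord; lia.
apply/negP; rewrite alt_endS => /(folding IHk); rewrite -alt_endS => E.
have /ord : (0 < k.+1 <= k.+1)%N by lia.
apply; apply/alt_prod_comm; rewrite ?coxeter_gen2 // -!coxeter_word_alt.
apply: invg_inj; rewrite -!coxeter_word_rev -/(alt_end k.+1 i j) E.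
by rewrite [in RHS]coxeter_word_rev /= coxeter_word_cons invgM coxeter_genV -coxeter_word_rev.
Qed.

Lemma alt_end_cons g k i j : g = i \/ g = j ->
  [\/ s g * alt_end k i j = alt_end k.+1 i j,
      k = 0%N /\ s g * alt_end k i j = alt_end 1 j i
    | exists2 l, k = l.+1 & s g * alt_end k i j = alt_end l i j].
Proof.
move=> gij; have [->|gn] := pselect (g = if odd k then i else j).
  by apply: Or31; rewrite -alt_endS.
have {gij gn}gE : g = if odd k then j else i.
  by move: gn; case: (odd k); case: gij.
case: k gE => [|k] gE.
  by apply: Or32; rewrite gE alt_endS /alt_end coxeter_word_nil.
by apply: Or33; exists k => //; rewrite alt_endS gE /= if_neg coxeter_genKl.
Qed.

Lemma dihedral_word i j u : J_word [set k | k = i \/ k = j] u ->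
    size u = length (word u) ->
  word u = alt_end (size u) i j \/ word u = alt_end (size u) j i.
Proof.
elim: u => [|g u IHu]; first by left; rewrite /alt_end.
case/andP => /set_mem gij Ju sz.
have szu : size u = length (word u).
  have := length_word m u; have := lengthM (s g) (word u).
  by rewrite -coxeter_word_cons -sz length_gen /=; lia.
have lg k a b : s g * word u = alt_end k a b -> (size u < k)%N.
  by move=> E; have := length_alt_end k a b; rewrite -E -coxeter_word_cons -sz.
rewrite /= coxeter_word_cons; case: (IHu Ju szu) => E; rewrite E in lg *.
  have [|[u0 E1]|[l ul E1]] := alt_end_cons (size u) gij; first by left.
    by right; rewrite E1 u0.
  by have := lg _ _ _ E1; lia.
have gji : g = j \/ g = i by case: gij; [right|left].
have [|[u0 E1]|[l ul E1]] := alt_end_cons (size u) gji; first by right.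
  by left; rewrite E1 u0.
by have := lg _ _ _ E1; lia.
Qed.

Lemma order_gt0 i j n : m i j = Some n -> (0 < n)%N.
Proof. by case: hm => _ m0 _; case: n => // /m0. Qed.

Lemma alt_end_braid i j n : m i j = Some n ->
  alt_end n i j = word (alt n i j) /\ alt_end n j i = word (alt n i j).
Proof.
by move=> mij; rewrite /alt_end !alt_rev; case: ifP; rewrite (coxeter_braidE mij).
Qed.

(* Two consecutive braid sides of length [n] collapse in a longer alternating *)
(* word, so a reduced one has at most [m i j] letters.                        *)
Lemma alt_end_long i j n k : m i j = Some n -> (n < k)%N ->
  (length (alt_end k i j) < k)%N.
Proof.
move=> mij; have [mC _ _] := hm; have n0 := order_gt0 mij.
move=> nk; rewrite /alt_end coxeter_word_rev lengthV -(subnKC nk) alt_cat.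
set r := if _ then _ else _.
have sr : size r = (k - n.+1)%N by rewrite /r; case: ifP; rewrite size_alt.
rewrite coxeter_word_cat; have := lengthM (word (alt n.+1 j i)) (word r).
have := length_word m r; rewrite sr.
have -> : word (alt n.+1 j i) = word (alt n.-1 i j).
  rewrite -[alt n.+1 j i]/(j :: alt n i j) coxeter_word_cons (coxeter_braidE mij).
  by rewrite -{1}(prednK n0) /= coxeter_word_cons coxeter_genKl.
by have := length_word m (alt n.-1 i j); rewrite size_alt; lia.
Qed.

Lemma dihedral_both i j u : J_word [set k | k = i \/ k = j] u ->
    size u = length (word u) -> rdes (word u) i -> rdes (word u) j ->
  exists2 n, m i j = Some n & word u = word (alt n i j) /\ size u = n.
Proof.
have [mC _ _] := hm.
have main a b v : word v = alt_end (size v) a b -> size v = length (word v) ->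
    rdes (word v) a ->
  exists2 n, m a b = Some n & word v = word (alt n a b) /\ size v = n.
  move=> vE sv va.
  have [n [nk sn]] : exists n, (0 < n <= size v)%N /\ (s b * s a) ^+ n = 1.
    move: va; rewrite vE; apply: contraPP => nex.
    apply/negP/alt_end_asc => n nk sn; apply: nex; exists n; split=> //.
  have [|k mba kn] := hord _ sn; first by lia.
  have mab : m a b = Some k by rewrite mC.
  have le : (k <= size v)%N by have := dvdn_leq _ kn; lia.
  exists k => //; have sk : size v = k.
    have [lt|] := ltnP k (size v); last by lia.
    by have := alt_end_long mab lt; rewrite -vE -sv ltnn.
  by rewrite vE sk; split=> //; case: (alt_end_braid mab).
move=> Ju sz ui uj; case: (dihedral_word Ju sz) => E; first exact: main.
have [n mji [uE un]] := main _ _ _ E sz uj; exists n; first by rewrite mC.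
by rewrite uE (coxeter_braidE mji).
Qed.

(** Both descents pass to the dihedral factor of [w], and a reduced dihedral word has two descents
    only when it is a full braid side. *)
Lemma two_descents w i j : rdes w i -> rdes w j -> i <> j ->
  exists n y, [/\ m i j = Some n, w = y * word (alt n i j),
    length w = (length y + n)%N & J_min [set k | k = i \/ k = j] y].
Proof.
move=> wi wj ij; set J := [set k | k = i \/ k = j].
have [y [u [wE yJ Ju l]]] := J_decompose J w.
have sz : size u = length (word u).
  have := lengthM y (word u); have := length_word m u; rewrite -wE; lia.
have des k : J k -> rdes w k -> rdes (word u) k.
  by rewrite wE => Jk; apply: J_decompose_des yJ Ju _ Jk; rewrite -wE.
have [||n mij [uE un]] := dihedral_both Ju sz; try by apply: des; rewrite // /J /=; auto.
by exists n, y; split; rewrite -?uE // l un.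
Qed.

Lemma length_alt_prod k i j :
    (forall n, (0 < n < k)%N -> (s i * s j) ^+ n <> 1) ->
  length (word (alt k i j)) = k.
Proof.
suff main a b : (forall n, (0 < n < k)%N -> (s a * s b) ^+ n <> 1) ->
    length (alt_end k a b) = k.
  move=> ord; rewrite -lengthV -coxeter_word_rev; apply: main => n nk E.
  apply: (ord n nk); apply: invg_inj; rewrite invg1 -E -expVgn invgM.
  by rewrite !coxeter_genV.
elim: k a b => [|k IHk] a b ord; first by rewrite /alt_end coxeter_word_nil length1.
have E : alt_end k.+1 a b = alt_end k b a * s b.
  by rewrite /alt_end -[alt k.+1 b a]/(b :: alt k a b) rev_cons coxeter_word_rcons.
rewrite E length_asc ?IHk // => [n nk F|].
  apply: (ord n); first by lia.
  apply: invg_inj; rewrite invg1 -F -expVgn invgM.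
  by rewrite !coxeter_genV.
by apply: alt_end_asc => n nk; apply: ord; lia.
Qed.

Lemma length_alt i j n : m i j = Some n -> length (word (alt n i j)) = n.
Proof.
move=> mij; apply: length_alt_prod => k /andP[k0 kn] /hord[//|l].
by rewrite mij => -[<-] /dvdn_leq; lia.
Qed.

(** * Matsumoto's theorem and lifts to the Artin-Tits group *)

Lemma reduced_rcons u i : size (rcons u i) = length (word (rcons u i)) ->
  size u = length (word u) /\ rdes (word (rcons u i)) i.
Proof.
rewrite /rdes coxeter_word_rcons coxeter_genK size_rcons => E.
have := lengthM (word u) (s i); have := length_word m u; rewrite length_gen.
by split; lia.
Qed.

Lemma alt_ends i j n : (0 < n)%N -> exists a b u v, 
  [/\ (a = i /\ b = j) \/ (a = j /\ b = i), alt n a b = rcons u i & alt n b a = rcons v j].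
Proof.
case: n => // n _; have [on|on] := boolP (odd n).
  exists j, i, (alt n j i), (alt n i j); rewrite !alt_rcons on; split=> //.
  by right.
exists i, j, (alt n i j), (alt n j i); rewrite !alt_rcons (negPf on); split=> //.
by left.
Qed.

(** Equal last letters are cancelled. Distinct ones are two descents, so [two_descents] gives
    reduced words with these last letters that differ by one braid relation, and induction links
    each to [u] or [v]. *)
Lemma matsumoto u v : word u = word v -> size u = length (word u) ->
  size v = length (word v) -> artin_word m u = artin_word m v.
Proof.
have [k] := ubnP (size u); elim: k u v => // k IHk u v.
case/lastP: u => [|u i].
  by rewrite coxeter_word_nil => _ <- _; rewrite length1 => /size0nil ->.
case/lastP: v => [|v j].
  by move=> _ ->; rewrite coxeter_word_nil length1 size_rcons.
move=> uk E szu szv; rewrite size_rcons ltnS in uk.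
have [su ui] := reduced_rcons szu; have [sv vj] := reduced_rcons szv.
have IH u1 a v1 : word (rcons u1 a) = word (rcons v1 a) -> (size u1 < k)%N ->
    size u1 = length (word u1) -> size v1 = length (word v1) ->
    artin_word m (rcons u1 a) = artin_word m (rcons v1 a).
  move=> E1 wk sw sz; rewrite /artin_word !big_rcons /=; congr (_ * _).
  by apply: IHk => //; move: E1; rewrite !coxeter_word_rcons => /mulIg.
have [ij|ij] := pselect (i = j).
  by rewrite -ij in E szv *; apply: IH.
rewrite -E in vj; have [n [y [mij yE l _]]] := two_descents ui vj ij.
have [a [b [p [q [ab pE qE]]]]] := alt_ends i j (order_gt0 mij).
have mab : m a b = Some n.
  by case: hm => mC _ _; case: ab => -[-> ->] //; rewrite mC.
have altab : word (alt n i j) = word (alt n a b).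
  by case: ab => -[-> ->] //; exact: coxeter_braidE.
have [z [zy sz]] := reduced_word_ex y.
have pP : word (rcons (z ++ p) i) = word (rcons u i).
  by rewrite rcons_cat -pE coxeter_word_cat zy -altab -yE.
have qP : word (rcons (z ++ q) j) = word (rcons u i).
  by rewrite rcons_cat -qE coxeter_word_cat zy -(coxeter_braidE mab) -altab -yE.
have sp : size (rcons p i) = n by rewrite -pE size_alt.
have sq : size (rcons q j) = n by rewrite -qE size_alt.
have [sp' _] : size (z ++ p) = length (word (z ++ p)) /\ rdes (word (rcons (z ++ p) i)) i.
  by apply: reduced_rcons; rewrite pP l -sp -sz !size_rcons size_cat addnS.
have [sq' _] : size (z ++ q) = length (word (z ++ q)) /\ rdes (word (rcons (z ++ q) j)) j.
  by apply: reduced_rcons; rewrite qP l -sq -sz !size_rcons size_cat addnS.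
have su' : size u = (size z + n).-1 by move: szu; rewrite l size_rcons sz => /eqP; lia.
rewrite (IH _ _ (z ++ p)) // -(IH (z ++ q) j v) //.
- by rewrite !rcons_cat -pE -qE !artin_word_cat (artin_braidE mab).
- by rewrite qP.
rewrite size_cat; move: sq; rewrite size_rcons; lia.
Qed.

Lemma artin_liftE u : size u = length (word u) -> lift (word u) = artin_word m u.
Proof.
move=> su; rewrite /artin_lift; case: xgetP => [_ -> [v [vu sv] ->]|/(_ (artin_word m u)) []].
  by apply: matsumoto => //; rewrite sv vu.
by exists u.
Qed.

Lemma artin_lift1 : lift 1 = 1.
Proof.
by rewrite -(coxeter_word_nil m) artin_liftE ?coxeter_word_nil ?length1 // /artin_word big_nil.
Qed.

Lemma artin_lift_gen i : lift (s i) = artin_gen m i.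
Proof.
by rewrite -coxeter_word1 artin_liftE ?coxeter_word1 ?length_gen // /artin_word big_seq1.
Qed.

Lemma artin_liftM x y : ladd x y -> lift (x * y) = lift x * lift y.
Proof.
have [u [<- su]] := reduced_word_ex x; have [v [<- sv]] := reduced_word_ex y.
rewrite /ladd -su -sv -size_cat -coxeter_word_cat => /eqP l.
by rewrite !artin_liftE // artin_word_cat.
Qed.

(* Strong induction on [length (word u)]: strip two letters, pull out the     *)
(* dihedral part of the rest, and compare it with the dihedral longest        *)
(* element, which divides by [two_descents].                                  *)
Lemma all_descents_suffix J z u : (forall i, J i -> rdes z i) -> J_word J u ->
  ladd (z * (word u)^-1) (word u).
Proof.
move=> zJ; have [k] := ubnP (length (word u)); elim: k u => // k IHk u.
rewrite ltnS => uk Ju; have [v [Jv vu sv]] := J_word_reduced m Ju.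
rewrite -{}vu in sv uk *; case: v => [|i [|j v]] in Jv sv uk *.
- by rewrite coxeter_word_nil ladd1r.
- move: Jv; rewrite /J_word /= andbT => /set_mem Ji.
  by rewrite coxeter_word1 coxeter_genV ladd_gen rdesN negbK zJ.
move: Jv; rewrite /J_word /= => /and3P[/set_mem Ji /set_mem Jj Jv].
rewrite /= in sv.
have ij : i <> j.
  move=> ij; move: sv; rewrite ij !coxeter_word_cons coxeter_genKl.
  by have := length_word m v; lia.
set K := [set l | l = i \/ l = j].
have [y [v' [yE yK Kv' yl]]] := J_decompose K (word v)^-1.
have Jv' : J_word J v'.
  apply: sub_all Kv' => l /set_mem Kl; apply/mem_set.
  by case: Kl => ->.
have pE : y^-1 = word (v' ++ v).
  by rewrite coxeter_word_cat -[word v]invgK yE invgM mulgA mulgV mul1g.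
have Jp : J_word J (v' ++ v) by rewrite J_word_cat Jv'.
rewrite lengthV in yl.
have lv : (length (word v) <= size v)%N by exact: length_word.
have sp l : K l -> length (word (l :: v' ++ v)) = (length y).+1.
  move=> Kl; rewrite coxeter_word_cons -pE -lengthV invgM invgK coxeter_genV.
  exact/length_asc/yK.
have IHp : ladd (z * y) y^-1.
  have := IHk (v' ++ v); rewrite -pE invgK lengthV; apply=> //; lia.
(* [s l * y^-1] is shorter than the given element, so by induction it is a suffix of [z], which
   makes [l] a descent of [z * y]. *)
have des l : K l -> J l -> rdes (z * y) l.
  move=> Kl Jl; have : ladd (z * (word (l :: v' ++ v))^-1) (word (l :: v' ++ v)).
    apply: IHk; first by rewrite sp //; lia.
    by rewrite /J_word /= mem_set.
  move: IHp; rewrite /ladd mulgK lengthV mulgVK sp //.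
  rewrite coxeter_word_cons -pE invgM invgK coxeter_genV coxeter_mulA /rdes.
  by move=> /eqP -> /eqP; lia.
have [n [y' [mij zyE zyl _]]] := two_descents (des i (or_introl erefl) Ji)
  (des j (or_intror erefl) Jj) ij.
pose w' := [:: i, j & rev v'].
have xE : word [:: i, j & v] = word w' * y^-1.
  rewrite /w' !coxeter_word_cons coxeter_word_rev pE coxeter_word_cat.
  by rewrite -!mulgA mulKg.
have Kw' : J_word K w'.
  rewrite /w' /J_word /= all_rev; apply/and3P; split=> //; apply/mem_set; [by left|by right].
have sw' : size w' = length (word w').
  have := lengthM (word w') y^-1; rewrite -xE -sv lengthV.
  by have := length_word m w'; rewrite /w' /= size_rev; lia.
have [rest restl restE] : exists2 rest : seq I, (size rest + size w')%N = n &
    word (alt n i j) = word rest * word w'.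
  have main a b : m a b = Some n -> word w' = alt_end (size w') a b ->
      exists2 rest : seq I, (size rest + size w')%N = n &
        word (alt n a b) = word rest * word w'.
    move=> mab E; have le : (size w' <= n)%N.
      by rewrite leqNgt; apply/negP => /(alt_end_long mab); rewrite -E -sw' ltnn.
    have [<- _] := alt_end_braid mab; set r := (n - size w')%N.
    exists (rev (if odd (size w') then alt r a b else alt r b a)).
      by rewrite size_rev; case: ifP; rewrite size_alt subnK.
    by rewrite E -coxeter_word_cat -rev_cat -alt_cat subnKC.
  case: (dihedral_word Kw' sw') => E; first exact: main.
  rewrite (coxeter_braidE mij); apply: main => //.
  by case: hm => mC _ _; rewrite mC.
have zE : z * (word [:: i, j & v])^-1 = y' * word rest.
  rewrite xE invgM invgK mulgA zyE restE mulgA mulgK //.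
have zl : length z = (length (z * y) + length y)%N.
  by move: IHp; rewrite /ladd mulgK lengthV => /eqP.
have := lengthM (z * (word [:: i, j & v])^-1) (word [:: i, j & v]).
rewrite /ladd mulgVK zE; have := lengthM y' (word rest); have := length_word m rest.
have := lengthM (word w') y^-1; rewrite -xE -sv lengthV /= => *; apply/eqP; lia.
Qed.

End Matsumoto.

(** * Longest elements *)

Section Generation.
Variables (G : groupType) (S : set G).

Lemma sub_gen : S `<=` gen S.
Proof. by move=> x Sx H [_]; apply. Qed.

Lemma gen1 : gen S 1.
Proof. by have [/set_mem] := gen_group_closed S. Qed.

Lemma genF x y : gen S x -> gen S y -> gen S (x / y).
Proof.
have [_ genD] := gen_group_closed S.
by move=> /mem_set Sx /mem_set Sy; apply/set_mem/genD.
Qed.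

Lemma genM x y : gen S x -> gen S y -> gen S (x * y).
Proof.
move=> Sx Sy; rewrite -[y]invgK; apply: genF => //.
by rewrite -div1g; apply: genF => //; exact: gen1.
Qed.

Lemma gen_sub (H : set G) : H 1 -> (forall x y, H x -> H y -> H (x / y)) ->
  S `<=` H -> gen S `<=` H.
Proof.
move=> H1 HF SH x; apply; split=> //; split; first exact/mem_set.
by move=> y z /set_mem Hy /set_mem Hz; apply/mem_set/HF.
Qed.

End Generation.

Lemma parabolicP I (m : I -> I -> option nat) (J : set I) w :
  @parabolic I m J w <-> exists2 u, J_word J u & coxeter_word m u = w.
Proof.
split=> [|[u]].
  move: w; apply: gen_sub => [|_ _ [u Ju <-] [v Jv <-]|_ [i Ji <-]].
  - by exists [::] => //; exact: coxeter_word_nil.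
  - exists (u ++ rev v); first by rewrite J_word_cat Ju J_word_rev.
    by rewrite coxeter_word_cat coxeter_word_rev.
  - by exists [:: i]; rewrite ?coxeter_word1 // /J_word /= mem_set.
elim: u w => [|i u IHu] w; first by rewrite coxeter_word_nil => _ <-; exact: gen1.
case/andP => /set_mem Ji Ju <-; rewrite coxeter_word_cons; apply: genM.
  by apply: sub_gen; exists i.
exact: IHu.
Qed.

Section LongestElements.
Variables (I : Type) (m : I -> I -> option nat).
Hypothesis hm : coxeter_matrix m.
Hypothesis hord : forall i j n, (0 < n)%N ->
  (coxeter_gen m i * coxeter_gen m j) ^+ n = 1 ->
  exists2 k, m i j = Some k & (k %| n)%N.
Notation W := (coxeter_group m).
Notation s := (coxeter_gen m).
Notation word := (coxeter_word m).
Implicit Types (i j : I) (u v : seq I) (w x y z t : W) (J : set I).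

Lemma length_eq1 w : length w = 1%N -> exists i, w = s i.
Proof.
have [u [<- <-]] := reduced_word_ex w; case: u => [|i [|]] // _.
by exists i; rewrite coxeter_word1.
Qed.

Lemma coxeter_gen_inj : injective s.
Proof.
move=> i j sij; have [mC _ m1] := hm; apply/m1.
have [|k -> ] := @hord i j 1 isT; first by rewrite expg1 sij coxeter_gen2.
by rewrite dvdn1 => /eqP ->.
Qed.

Lemma parabolic_gen J i : @parabolic I m J (s i) -> J i.
Proof.
move=> /parabolicP[u Ju ui]; have [v [Jv vu sv]] := J_word_reduced m Ju.
rewrite ui length_gen in sv; case: v sv vu Jv => [|j [|]] //= _.
by rewrite ui coxeter_word1 => /coxeter_gen_inj -> /andP[/set_mem].
Qed.

Lemma gen_exchange_parabolic J u i : J_word J u -> rdes (word u) i -> J i.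
Proof.
move=> Ju des; have [u1 [j [u2 [uE E]]]] := exchange des; apply: parabolic_gen; apply/parabolicP.
exists (rev u ++ (u1 ++ u2)).
  by move: Ju; rewrite J_word_cat J_word_rev uE !J_word_cat /= => /and3P[-> -> ->].
by rewrite coxeter_word_cat coxeter_word_rev -E mulKg.
Qed.

Lemma longest_ex J : spherical m J -> exists r, @parabolic I m J r /\
  forall w, @parabolic I m J w -> (length w <= length r)%N.
Proof.
move=> /finite_seqP[l lE].
pose P n := `[< exists2 w, @parabolic I m J w & length w = n >].
have exP : exists n, P n by exists 0%N; apply/asboolP; exists 1; rewrite ?length1 //; exact: gen1.
have Pb n : P n -> (n <= \max_(w <- l) length w)%N.
  move=> /asboolP[w Jw <-]; apply: leq_bigmax_seq => //.
  by move: Jw; rewrite lE.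
case: (ex_maxnP exP Pb) => n /asboolP[r Jr <-] rmax; exists r; split=> // w Jw.
by apply: rmax; apply/asboolP; exists w.
Qed.

Section Longest.
Variable J : set I.
Hypothesis Jsph : spherical m J.
Let r := longest m J.

Lemma longest_spec : @parabolic I m J r /\
  forall w, @parabolic I m J w -> (length w <= length r)%N.
Proof. exact: (xgetPex 1 (longest_ex Jsph)). Qed.

Lemma longest_word : exists u, [/\ J_word J u, word u = r & size u = length r].
Proof.
have [/parabolicP[u Ju ur] _] := longest_spec.
by have [v [Jv vu sv]] := J_word_reduced m Ju; exists v; rewrite -ur; split.
Qed.

Lemma parabolic_max_des w i : parabolic J w -> length w = length r -> J i -> rdes w i.
Proof.
move=> Jw wr Ji; have [_ rmax] := longest_spec.
have [//|asc] := boolP (rdes w i); have E := length_asc asc.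
have /rmax : parabolic J (w * s i) by apply: genM => //; apply: sub_gen; exists i.
by rewrite E wr ltnn.
Qed.

Lemma longest_des i : J i -> rdes r i.
Proof. by have [Jr _] := longest_spec; exact: parabolic_max_des. Qed.

Lemma des_longest i : rdes r i -> J i.
Proof.
by have [u [Ju <- _]] := longest_word; exact: gen_exchange_parabolic.
Qed.

(** Taking off the suffix [r^-1] from [r] leaves no length for [r * r]. *)
Lemma longest2 : r * r = 1.
Proof.
have [u [Ju ur _]] := longest_word.
have := all_descents_suffix hm hord longest_des (u := rev u).
rewrite J_word_rev coxeter_word_rev ur invgK => /(_ Ju).
rewrite /ladd mulgK lengthV => /eqP E; apply: length_eq0; lia.
Qed.

Lemma longestV : r^-1 = r.
Proof. exact/mulg1_eq/longest2. Qed.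

Lemma descents_ladd w : (forall i, J i -> rdes w i) -> ladd (w * r) r.
Proof.
have [u [Ju ur _]] := longest_word => /(all_descents_suffix hm hord) => /(_ _ Ju).
by rewrite ur longestV.
Qed.

Lemma J_min_ladd w : J_min J w -> ladd w r.
Proof.
have [u [Ju ur su]] := longest_word => wJ.
by have := J_min_add wJ Ju; rewrite /ladd ur su => ->.
Qed.

Lemma parabolic_all_des w : @parabolic I m J w -> (forall i, J i -> rdes w i) -> w = r.
Proof.
move=> Jw /descents_ladd; rewrite /ladd -mulgA longest2 mulg1 => /eqP E.
have [_ /(_ w Jw) le] := longest_spec.
have /length_eq0 : length (w * r) = 0%N by lia.
by move=> /mulg1_eq wr; rewrite -[w]invgK wr longestV.
Qed.

Lemma parabolic_length w : @parabolic I m J w -> length w = length r -> w = r.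
Proof.
by move=> Jw wr; apply: parabolic_all_des => // i; exact: parabolic_max_des.
Qed.

End Longest.

(** * Elements having every generator as a descent *)

Section FullDescents.
Variable z : W.
Hypothesis zdes : forall i, rdes z i.

Lemma full_suffix x : ladd (z * x^-1) x.
Proof.
have [u [<- _]] := reduced_word_ex x.
apply: (all_descents_suffix hm hord (J := setT)) => //.
by elim: u => //= i u ->; rewrite in_setT.
Qed.

Lemma full2 : z * z = 1.
Proof.
have := full_suffix z^-1; rewrite /ladd invgK mulgK lengthV => /eqP E.
by apply: length_eq0; lia.
Qed.

Lemma fullV : z^-1 = z.
Proof. exact/mulg1_eq/full2. Qed.

(** Conjugation by [z] permutes the generators, because [full_suffix] leaves length one for
    [z * s i * z]. *)
Lemma full_gen i : exists2 j, z * s i = s j * z & z * s j = s i * z.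
Proof.
have [|j jE] := @length_eq1 (z * s i * z).
  have := full_suffix (z * s i); have := length_des (zdes i).
  by rewrite /ladd mulgVK invgM coxeter_genV fullV coxeter_mulA => <- /eqP; lia.
exists j; rewrite -jE -mulgA ?full2 ?mulg1 //.
by rewrite !mulgA full2 mul1g.
Qed.

Lemma full_ladd_l i : ladd (s i) (s i * z).
Proof.
have := full_suffix (s i * z); rewrite invgM fullV mulgA full2 mul1g.
by rewrite coxeter_genV.
Qed.

End FullDescents.

End LongestElements.

(** * The action on greedy normal forms *)

Lemma J_word_alt I (J : set I) n i j : J i -> J j -> J_word J (alt n i j).
Proof.
elim: n i j => // n IHn i j Ji Jj.
by rewrite /J_word /= mem_set //; exact: IHn.
Qed.

Section GreedyAction.
Variables (I : Type) (m : I -> I -> option nat).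
Hypothesis hm : coxeter_matrix m.
Hypothesis hord : forall i j n, (0 < n)%N ->
  (coxeter_gen m i * coxeter_gen m j) ^+ n = 1 ->
  exists2 k, m i j = Some k & (k %| n)%N.
Notation W := (coxeter_group m).
Notation s := (coxeter_gen m).
Notation word := (coxeter_word m).
Implicit Types (i j : I) (u : seq I) (v w x y z t a b : W) (l : seq W).

(** The right weak order, that is, divisibility by prefixes. *)
Definition weak_le x y : bool := ladd x (x^-1 * y).

Lemma weak_leM x y : weak_le x (x * y) = ladd x y.
Proof. by rewrite /weak_le mulKg. Qed.

Lemma weak_leP x y : weak_le x y -> exists2 z, y = x * z & ladd x z.
Proof. by move=> xy; exists (x^-1 * y); rewrite ?mulVKg. Qed.

Lemma weak_le_length x y : weak_le x y -> (length x <= length y)%N.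
Proof. by case/weak_leP => z -> /eqP ->; exact: leq_addr. Qed.

Lemma weak_le_refl x : weak_le x x.
Proof. by rewrite /weak_le mulVg ladd1r. Qed.

Lemma weak_le1 x : weak_le 1 x.
Proof. exact: ladd1l. Qed.

Lemma weak_le_trans y x z : weak_le x y -> weak_le y z -> weak_le x z.
Proof.
case/weak_leP => p -> xp /weak_leP[q -> xpq].
by have [? _] := laddAr xp xpq; rewrite -coxeter_mulA weak_leM.
Qed.

Lemma weak_le_eq x y : weak_le x y -> (length y <= length x)%N -> x = y.
Proof.
case/weak_leP => z -> /eqP -> le; rewrite (@length_eq0 _ _ z) ?mulg1 //; lia.
Qed.

Lemma weak_le_step y x : weak_le y x -> y <> x ->
  exists2 i, ~~ rdes y i & weak_le (y * s i) x.
Proof.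
case/weak_leP => z -> yz yx; have [|i zi] := @rdes_neq1 _ _ z^-1.
  by move=> z1; apply: yx; rewrite -[z]invgK z1 invg1 mulg1.
have iz : ladd (s i) (s i * z).
  by rewrite laddV invgM coxeter_genV ladd_gen rdesN negbK.
rewrite -[z](coxeter_genKl i) in yz *.
have [ysi ysz] := laddAl yz iz; exists i; first by rewrite -ladd_gen.
by rewrite coxeter_mulA weak_leM.
Qed.

Definition headroom v w x : bool := weak_le x w && ladd v x.

Lemma headroom_le v w x y : weak_le x y -> headroom v w y -> headroom v w x.
Proof.
move=> xy /andP[yw vy]; rewrite /headroom (weak_le_trans xy yw).
by case/weak_leP: xy vy => z -> xz vy; have [] := laddAl vy xz.
Qed.

Lemma weak_le_left_des y x i : ~~ rdes y i -> weak_le (y * s i) (y * x) ->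
  rdes x^-1 i /\ ladd y x.
Proof.
move=> asc /weak_leP[z]; rewrite -coxeter_mulA => /mulgI -> /eqP.
rewrite -coxeter_mulA /ladd length_asc // => E.
have := lengthM y (s i * z); have := lengthM (s i) z; rewrite length_gen.
have zE : (s i * z)^-1 * s i = z^-1 by rewrite invgM coxeter_genV coxeter_genK.
rewrite /rdes zE !lengthV.
by split; [|apply/eqP]; lia.
Qed.

(** The bound is [y] times the longest dihedral element: a prefix of [w] by [two_descents] on
    inverses, and absorbed by [v] because [v * y] has neither [i] nor [j] as a descent. *)
Lemma headroom_join v w y i j : i <> j -> ~~ rdes y i -> ~~ rdes y j ->
    headroom v w (y * s i) -> headroom v w (y * s j) ->
  exists x, [/\ headroom v w x, weak_le (y * s i) x & weak_le (y * s j) x].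
Proof.
move=> ij yi yj /andP[wi vi] /andP[wj vj].
have yw : weak_le y w.
  by apply: weak_le_trans wi; rewrite weak_leM ladd_gen.
have [x wE _] := weak_leP yw; rewrite {}wE in wi wj *.
have [xi yx] := weak_le_left_des yi wi; have [xj _] := weak_le_left_des yj wj.
have [n [y' [mij xE xl _]]] := two_descents hm hord xi xj ij.
set r := word (alt n i j) in xE.
have rl : length r = n by exact: length_alt.
have n0 := order_gt0 hm mij.
have rV : r^-1 = r.
  by rewrite /r -coxeter_word_rev alt_rev; case: ifP; rewrite (coxeter_braidE mij).
rewrite lengthV in xl.
have {xE}xE : x = r * y'^-1 by rewrite -[r]rV -invgM -xE invgK.
have wE : y * x = y * r * y'^-1 by rewrite xE coxeter_mulA.
have yr : ladd y r.
  have := lengthM (y * r) y'^-1; have := lengthM y r; rewrite -wE lengthV /ladd rl (eqP yx) xl.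
  by clear; move=> *; apply/eqP; lia.
have [rj rjE] : ladd (s j) (s j * r) /\ ladd (s i) (s i * r).
  have dihed (a b : I) : r = word (alt n a b) -> ladd (s a) (s a * r).
    move=> rE; rewrite /ladd coxeter_genKl rl length_gen.
    have := lengthM (s a) (s a * r); rewrite coxeter_genKl rl length_gen.
    have : (length (s a * r) <= n.-1)%N.
      rewrite rE -(prednK n0) /= coxeter_word_cons coxeter_genKl.
      by rewrite (leq_trans (length_word _ _)) // size_alt.
    by move: n0; clear; move=> *; apply/eqP; lia.
  by split; apply: dihed; rewrite /r // (coxeter_braidE mij).
exists (y * r); split.
- apply/andP; split.
    rewrite wE weak_leM /ladd -wE (eqP yx) (eqP yr) rl lengthV xl.
    by rewrite [(length y' + n)%N]addnC addnA.
  have step k : ~~ rdes y k -> ladd v (y * s k) -> ladd v y /\ ~~ rdes (v * y) k.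
    by rewrite -!ladd_gen => yk vk; exact: laddAl.
  have [vy vyi] := step _ yi vi; have [_ vyj] := step _ yj vj.
  have K : J_min [set k | k = i \/ k = j] (v * y) by move=> k [] ->.
  have Kr : J_word [set k | k = i \/ k = j] (alt n i j).
    by apply: J_word_alt; [left|right].
  have := J_min_add K Kr; rewrite size_alt rl => /(_ erefl) E.
  by rewrite /ladd coxeter_mulA E (eqP yr) rl (eqP vy) addnA.
- rewrite -[r](coxeter_genKl i) in yr *; have [_] := laddAl yr rjE.
  by rewrite -weak_leM (coxeter_mulA y).
rewrite -[r](coxeter_genKl j) in yr *; have [_] := laddAl yr rj.
by rewrite -weak_leM (coxeter_mulA y).
Qed.

(* Newman's lemma for the ascending chains inside [headroom v w]. *)
Lemma headroom_max_above v w y : headroom v w y ->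
  exists M, headroom v w M /\
    forall x, headroom v w x -> weak_le y x -> weak_le x M.
Proof.
have [k] := ubnP (length w - length y); elim: k y => // k IHk y yk Cy.
have [[i [yi Ci]]|none] := pselect (exists i, ~~ rdes y i /\ headroom v w (y * s i)); last first.
  exists y; split=> // x Cx yx; have [->|/eqP yNx] := eqVneq y x; first exact: weak_le_refl.
  have [i yi ix] := weak_le_step yx yNx; case: none; exists i.
  by split=> //; exact: headroom_le Cx.
have IH j : ~~ rdes y j -> headroom v w (y * s j) -> exists M, headroom v w M /\
    forall x, headroom v w x -> weak_le (y * s j) x -> weak_le x M.
  move=> yj Cj; apply: IHk => //; have /weak_le_length := proj1 (andP Cj).
  by rewrite length_asc //; lia.
have [M [CM Mmax]] := IH i yi Ci; exists M; split=> // x Cx yx.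
have [<-|/eqP yNx] := eqVneq y x.
  apply: weak_le_trans (Mmax _ Ci (weak_le_refl _)).
  by rewrite weak_leM ladd_gen.
have [j yj jx] := weak_le_step yx yNx.
have [ji|ij] := pselect (j = i); first by rewrite ji in jx; exact: Mmax.
have Cj := headroom_le jx Cx.
have [M' [CM' M'max]] := IH j yj Cj.
have [t [Ct it jt]] := headroom_join (nesym ij) yi yj Ci Cj.
apply: (weak_le_trans (M'max _ Cx jx)); apply: Mmax => //.
exact: weak_le_trans it (M'max _ Ct jt).
Qed.

Lemma headroom_max_ex v w : exists M, headroom v w M /\
  forall x, headroom v w x -> weak_le x M.
Proof.
have [|M [CM Mmax]] := @headroom_max_above v w 1.
  by rewrite /headroom weak_le1 ladd1r.
by exists M; split=> // x Cx; apply: Mmax => //; exact: weak_le1.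
Qed.

(* The largest prefix of [w] that [v] can absorb: [v * grab v w] is the       *)
(* greatest simple divisor of the product of the lifts of [v] and [w].        *)
Definition grab v w : W :=
  xget 1 [set M | headroom v w M /\ forall x, headroom v w x -> weak_le x M].

Lemma grabP v w : [/\ weak_le (grab v w) w, ladd v (grab v w) &
  forall x, weak_le x w -> ladd v x -> weak_le x (grab v w)].
Proof.
have [/andP[gw vg] gmax] := xgetPex 1 (headroom_max_ex v w).
by split=> // x xw vx; apply: gmax; apply/andP.
Qed.

Lemma grab_unique v w x : weak_le x w -> ladd v x ->
  (length (grab v w) <= length x)%N -> grab v w = x.
Proof.
move=> xw vx le; have [_ _ gmax] := grabP v w.
by apply/esym/weak_le_eq => //; exact: gmax.
Qed.

Lemma grab_ladd v w : ladd v w -> grab v w = w.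
Proof.
move=> vw; apply: grab_unique => //; first exact: weak_le_refl.
by have [/weak_le_length] := grabP v w.
Qed.

(* Left multiplication by a simple element on left-greedy normal forms. *)
Fixpoint act v l : seq W :=
  if l is w :: l' then v * grab v w :: act ((grab v w)^-1 * w) l'
  else if v == 1 then [::] else [:: v].

Lemma act1 l : act 1 l = l.
Proof.
elim: l => [|w l IHl] /=; first by rewrite eqxx.
by rewrite grab_ladd ?ladd1l // mul1g mulVg IHl.
Qed.

(** What [a * b] absorbs from [w] is already absorbed by [b], and [a] then takes exactly [b] with
    that part. *)
Lemma grab_mul a b w : ladd a b ->
  grab a (b * grab b w) = b * grab (a * b) w.
Proof.
move=> ab; set M := grab (a * b) w; set Mb := grab b w.
have [Mbw bMb Mbmax] := grabP b w; have [Mw abM Mmax] := grabP (a * b) w.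
rewrite -/Mb in Mbw bMb Mbmax; rewrite -/M in Mw abM Mmax.
have [abM' bM] := laddAr ab abM.
have MMb := Mbmax _ Mw bM.
have [Nl aN Nmax] := grabP a (b * Mb).
have bN : weak_le b (grab a (b * Mb)) by apply: Nmax; rewrite ?weak_leM.
have [y NE byl] := weak_leP bN; rewrite NE in Nl aN.
have aby : ladd (a * b) y by have [] := laddAl aN byl.
have yMb : weak_le y Mb.
  case/weak_leP: Nl => z; rewrite -coxeter_mulA => /mulgI -> byz.
  by rewrite weak_leM; have [] := laddAr byl byz.
have yM := Mmax _ (weak_le_trans yMb Mbw) aby.
apply: grab_unique => //.
  case/weak_leP: MMb bMb => z -> Mz bMz.
  by rewrite coxeter_mulA weak_leM; have [] := laddAl bMz Mz.
by rewrite NE (eqP byl) (eqP bM) leq_add2l weak_le_length.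
Qed.

(** Both sides of a braid relation are length-additive products with the same value, so they act in
    the same way. *)
Lemma actM a b l : ladd a b -> act (a * b) l = act a (act b l).
Proof.
elim: l a b => [|w l IHl] a b ab.
  have [->|b1] := eqVneq b 1; first by rewrite mulg1 act1.
  have [->|a1] := eqVneq a 1; first by rewrite mul1g act1.
  rewrite /= (negPf b1) /= grab_ladd // mulVg eqxx.
  case: eqP => // ab1; case/eqP: b1; apply: length_eq0.
  by move: ab; rewrite /ladd ab1 length1 => /eqP; lia.
rewrite /= grab_mul // coxeter_mulA; congr (_ :: _).
have [Mbw bMb Mbmax] := grabP b w; have [Mw abM _] := grabP (a * b) w.
have [_ bM] := laddAr ab abM; have MMb := Mbmax _ Mw bM.
set M := grab (a * b) w in Mw abM bM MMb *; set Mb := grab b w in Mbw bMb MMb *.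
have -> : (b * M)^-1 * (b * Mb) = M^-1 * Mb by rewrite invgM -coxeter_mulA mulKg.
rewrite -IHl; first by rewrite -coxeter_mulA mulVKg.
move: Mbw; rewrite /weak_le -{1}(mulVKg M Mb) => MMbw.
by have [] := laddAr MMb MMbw.
Qed.

Definition act_word u l := foldr (fun i => act (s i)) l u.

Lemma act_word_cat u (u' : seq I) l : act_word (u ++ u') l = act_word u (act_word u' l).
Proof. exact: foldr_cat. Qed.

Lemma act_wordE u l : size u = length (word u) -> act_word u l = act (word u) l.
Proof.
elim: u => [|i u IHu]; first by rewrite coxeter_word_nil act1.
rewrite coxeter_word_cons => sz.
have su : size u = length (word u).
  have := lengthM (s i) (word u); have := length_word m u.
  by rewrite -sz length_gen /=; lia.
rewrite actM -?IHu // /ladd -sz /= length_gen; apply/eqP; lia.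
Qed.

(** * Formal inverses and central powers *)

Section Localisation.
Variable z : W.
Hypothesis zdes : forall i, rdes z i.

Definition act_square l := act z (act z l).

Lemma act_full_gen i : exists j, (forall l, act z (act (s i) l) = act (s j) (act z l)) /\
  (forall l, act z (act (s j) l) = act (s i) (act z l)) /\ z * s j = s i * z.
Proof.
have [j zi zj] := full_gen hm hord zdes i; exists j.
have main (a b : I) l : z * s a = s b * z -> act z (act (s a) l) = act (s b) (act z l).
  move=> zab; rewrite -{1}[z](coxeter_genKl b) -zab.
  rewrite actM; last first.
    by rewrite zab; exact: full_ladd_l.
  rewrite -(@actM (z * s a)); last by rewrite ladd_gen rdesN zdes.
  by rewrite coxeter_genK.
by split=> [l|]; [|split=> // l]; apply: main.
Qed.

Lemma act_square_gen i l : act_square (act (s i) l) = act (s i) (act_square l).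
Proof.
by have [j [E1 [E2 _]]] := act_full_gen i; rewrite /act_square E1 E2.
Qed.

Lemma act_squareC w l : act_square (act w l) = act w (act_square l).
Proof.
have [u [<- su]] := reduced_word_ex w; rewrite -!act_wordE //.
by elim: u {su} => //= i u IHu; rewrite act_square_gen IHu.
Qed.

(* A formal inverse acts as [s_i^{-1} z^2]; the powers of the central [z^2]   *)
(* thus introduced are counted by [negatives].                                *)
Definition signed_act (p : I * bool) l : seq W :=
  if p.2 then act (s p.1) l else act (s p.1 * z) (act z l).

Definition negatives (u : seq (I * bool)) := count (fun p => ~~ p.2) u.

Lemma signed_act_positive u l : foldr signed_act l (positive u) = act_word u l.
Proof. by elim: u => //= i u ->. Qed.

Lemma negatives_positive u : negatives (positive u) = 0%N.
Proof. by elim: u. Qed.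

Lemma iter_squareC k (u : seq (I * bool)) l : iter k act_square (foldr signed_act l u) =
  foldr signed_act (iter k act_square l) u.
Proof.
elim: k => //= k ->; elim: u => // -[i b] u IHu /=; rewrite -IHu /signed_act /=.
by case: b; rewrite act_squareC //.
Qed.

(** Each side is corrected by the number of inverse letters of the other. The extra [k] replaces the
    cancellation of powers of [act_square] that transitivity would call for. *)
Lemma pres_eq_act (u v : seq (I * bool)) : pres_eq (artin_rel m) u v ->
  exists k, forall l, iter (k + negatives v) act_square (foldr signed_act l u) =
                      iter (k + negatives u) act_square (foldr signed_act l v).
Proof.
elim=> {u v} [u|u v _ [k E]|v u p _ [k E] _ [k' E']
             |u u' v v' _ [k E] _ [k' E']|i b|u v [i j n mij]].
- by exists 0%N.
- by exists k.
- exists (k + k' + negatives v)%N => l.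
  have -> : (k + k' + negatives v + negatives p = k' + negatives p + (k + negatives v))%N by lia.
  rewrite iterD E -iterD.
  have -> : (k' + negatives p + (k + negatives u) = k + negatives u + (k' + negatives p))%N by lia.
  by rewrite iterD E' -iterD; congr (iter _ _ _); lia.
- exists (k + k')%N => l; rewrite /negatives !count_cat -!/(negatives _) !foldr_cat.
  have -> : (k + k' + (negatives u' + negatives v') =
    k' + negatives v' + (k + negatives u'))%N by lia.
  rewrite iterD E -iterD.
  have -> : (k' + negatives v' + (k + negatives u) =
    k + negatives u + (k' + negatives v'))%N by lia.
  rewrite iterD iter_squareC E' -iter_squareC -iterD; congr (iter _ _ _); lia.
- exists 0%N => l /=; rewrite /signed_act /=; case: b => /=.
    by rewrite -actM ?coxeter_genKl //; exact: full_ladd_l.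
  have [j [E1 [_ zj]]] := act_full_gen i.
  rewrite E1 -zj -actM ?coxeter_genK //.
  by rewrite ladd_gen rdesN zdes.
exists 0%N => l; rewrite !signed_act_positive !negatives_positive /=.
have li := length_alt hord mij.
by rewrite !act_wordE ?size_alt -?(coxeter_braidE mij) ?li.
Qed.

(** The hypothesis is an equality in the group, so no embedding of the positive monoid is
    presupposed. *)
Lemma artin_word_act u (u' : seq I) : artin_word m u = artin_word m u' ->
  exists k, forall l, iter k act_square (act_word u l) =
                      iter k act_square (act_word u' l).
Proof.
rewrite !artin_wordE => /pres_classP uv; have [k E] := pres_eq_act uv; exists k => l.
by have := E l; rewrite !signed_act_positive !negatives_positive addn0.
Qed.

End Localisation.

(** A greedy step only moves a factor from one lift to the preceding one. *)
Lemma act_lift v l : \prod_(w <- act v l) artin_lift w =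
  artin_lift v * \prod_(w <- l) artin_lift w.
Proof.
elim: l v => [|w l IHl] v /=.
  have [->|v1] := eqVneq v 1; first by rewrite !big_nil artin_lift1 ?mulg1 ?mul1g.
  by rewrite big_nil big_seq1 mulg1.
rewrite !big_cons IHl; have [gw vg _] := grabP v w.
rewrite (artin_liftM hm hord vg) -!mulgA; congr (_ * _).
by rewrite mulgA -(artin_liftM hm hord gw) mulVKg.
Qed.

End GreedyAction.

(** * The folding homomorphism *)

Section Order.
Variable G : groupType.
Implicit Types x y : G.

Lemma order_Some x n : order x = Some n ->
  [/\ (0 < n)%N, x ^+ n = 1 & forall k, x ^+ k = 1 -> (n %| k)%N].
Proof.
rewrite /order; case: pselect => // ex [<-]; case: ex_minnP => d /andP[d0 /eqP xd] dmin.
split=> // k xk; apply: contraTT isT => ndk; have kd : (0 < k %% d)%N by rewrite lt0n.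
have /dmin : (0 < k %% d)%N && (x ^+ (k %% d) == 1).
  rewrite kd /=; apply/eqP; move: xk.
  by rewrite {1}(divn_eq k d) expgnDr mulnC expgnA xd expg1n mul1g.
by rewrite leqNgt ltn_mod d0.
Qed.

Lemma order_exists x n : (0 < n)%N -> x ^+ n = 1 -> exists k, order x = Some k.
Proof.
move=> n0 xn; rewrite /order; case: pselect => [ex|[]]; first by exists (ex_minn ex).
by exists n; rewrite n0 xn eqxx.
Qed.

Lemma eq_order x y : (forall n, x ^+ n = 1 <-> y ^+ n = 1) -> order x = order y.
Proof.
move=> xy; case xE: (order x) => [n|].
  have [n0 xn ndv] := order_Some xE; have [k yE] := order_exists n0 ((xy n).1 xn).
  rewrite yE; have [k0 yk kdv] := order_Some yE; congr Some.
  by apply/eqP; rewrite eqn_dvd ndv ?kdv //; apply/xy.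
case yE: (order y) => [k|] //; have [k0 yk _] := order_Some yE.
by have [n] := order_exists k0 ((xy k).2 yk); rewrite xE.
Qed.

End Order.

(* [move:] abstracts a length up to conversion, whereas [lia] would distinguish *)
(* convertible copies of the group structure.                                  *)
Ltac length_lia := clear;
  repeat match goal with |- context [length ?x] => move: (length x) => ? end; lia.

Section Folding.
Variables (I : Type) (m : I -> I -> option nat) (P : set (set I)).
Hypotheses (hm : coxeter_matrix m) (hP : admissible m P).
Let hord := @coxeter_gen_order I m hm.
Notation W := (coxeter_group m).
Notation s := (coxeter_gen m).
Notation word := (coxeter_word m).
Notation mt := (partition_type m P).
Notation Wt := (coxeter_group mt).
Notation st := (coxeter_gen mt).
Notation wordt := (coxeter_word mt).
Let r (a : set_type P) : W := longest m (val a).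
Implicit Types (i j : I) (a b c : set_type P) (w x y z : W).

Lemma part_mem a : P (val a).
Proof. exact: set_mem (valP a). Qed.

Lemma part_spherical a : spherical m (val a).
Proof. by have [[_ sph] _] := hP; exact: sph (part_mem a). Qed.

Lemma part_cover i : exists a, val a i.
Proof.
have [[[cov _ _] _] _] := hP.
have [J PJ Ji] : cover P id i by rewrite cov.
by exists (exist _ J (mem_set PJ)).
Qed.

Lemma part_nonempty a : exists i, val a i.
Proof. by have [[[_ _ ne] _] _] := hP; exact: ne (part_mem a). Qed.

Lemma part_disjoint a b i : val a i -> val b i -> a = b.
Proof.
have [[[_ triv _] _] _] := hP => ai bi; apply: val_inj.
by apply: triv; rewrite ?part_mem //; [exact: part_mem|exact: part_mem|exists i].
Qed.

Lemma fold_gen2 a : r a * r a = 1.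
Proof. exact (longest2 hm hord (part_spherical a)). Qed.

Lemma fold_genV a : (r a)^-1 = r a.
Proof. exact/mulg1_eq/fold_gen2. Qed.

Lemma fold_des a i : rdes (r a) i <-> val a i.
Proof.
split; first exact (@des_longest _ _ hm hord _ (part_spherical a) i).
exact (@longest_des _ _ _ (part_spherical a) i).
Qed.

Lemma fold_gen_length a : (0 < length (r a))%N.
Proof.
have [i /fold_des] := part_nonempty a.
by rewrite /rdes; exact: leq_ltn_trans.
Qed.

Lemma fold_gen_inj : injective r.
Proof.
move=> a b ab; have [i ai] := part_nonempty a; apply: (part_disjoint ai).
by apply/fold_des; rewrite -ab; apply/fold_des.
Qed.

Lemma fold_matrix : coxeter_matrix mt.
Proof.
split=> [a b|a b /order_Some[]//|a b].
- apply: eq_order => n; rewrite -/(r a) -/(r b).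
  have -> : r b * r a = (r a * r b)^-1 by rewrite invgM !fold_genV.
  rewrite expVgn; split=> [->|/(congr1 (fun x : W => x^-1))]; first exact: invg1.
  by rewrite invgK invg1.
- split=> [/order_Some[_ + _]|->].
    rewrite expg1 => /mulg1_eq; rewrite -/(r a) fold_genV => ab; exact: fold_gen_inj.
  have [|n nE] := @order_exists _ (r b * r b) 1 isT.
    by rewrite expg1 fold_gen2.
  have [_ _ /(_ 1%N)] := order_Some nE; rewrite expg1 fold_gen2 => /(_ erefl).
  by rewrite -[mt b b]/(order (r b * r b)) nE dvdn1 => /eqP ->.
Qed.

Lemma fold_ex : exists psi : {multiplicative Wt -> W}, forall a, psi (st a) = r a.
Proof.
apply: coxeter_lift => [a|a b n /order_Some[_ -> _]] //; exact: fold_gen2.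
Qed.

(** * Descents along the folding homomorphism *)

Variable psi : Wt -> W.
Hypothesis psiM : forall v v', psi (v * v') = psi v * psi v'.
Hypothesis psi_gen : forall a, psi (st a) = r a.
Implicit Types (v t : Wt).

Lemma psi1 : psi 1 = 1.
Proof. by apply: (mulgI (psi 1)); rewrite -psiM !mulg1. Qed.

Lemma psiV v : psi v^-1 = (psi v)^-1.
Proof. by apply/esym/mulg1_eq; rewrite -psiM mulgV psi1. Qed.

Lemma psiX v n : psi (v ^+ n) = psi v ^+ n.
Proof. by elim: n => [|n IHn]; rewrite ?expg0 ?psi1 // !expgS psiM IHn. Qed.

Lemma psi_word u : psi (wordt u) = \prod_(a <- u) r a.
Proof.
elim: u => [|a u IHu]; first by rewrite coxeter_word_nil psi1 big_nil.
by rewrite coxeter_word_cons psiM IHu psi_gen big_cons.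
Qed.

Lemma fold_order a b n : (0 < n)%N -> (st a * st b) ^+ n = 1 ->
  exists2 k, mt a b = Some k & (k %| n)%N.
Proof.
move=> n0 /(congr1 psi); rewrite psiX psiM !psi_gen psi1 => E.
have [k kE] := order_exists n0 E; exists k => //.
by have [_ _] := order_Some kE; exact.
Qed.

Lemma psi_mem v : gen (longest m @` P) (psi v).
Proof.
have [u [<- _]] := reduced_word_ex v; rewrite psi_word.
elim: u => [|a u IHu]; first by rewrite big_nil; exact: gen1.
rewrite big_cons; apply: genM => //; apply: sub_gen.
by exists (val a) => //; exact: part_mem.
Qed.

Definition psi_des v a := forall i, val a i -> rdes (psi v) i.

Lemma psi_dichotomy v a : J_min (val a) (psi v) \/ psi_des v a.
Proof.
have [_ adm] := hP; have [asc|des] := adm _ _ (psi_mem v) (part_mem a).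
  by left=> i /asc; rewrite /rdes /ascents /= => ->; rewrite -leqNgt.
by right=> i /des; rewrite /rdes /descents /= => <-.
Qed.

Lemma psi_min_ladd v a : J_min (val a) (psi v) -> ladd (psi v) (r a).
Proof. exact (@J_min_ladd _ _ _ (part_spherical a) _). Qed.

Lemma psi_des_ladd v a : psi_des v a -> ladd (psi v * r a) (r a).
Proof. exact (@descents_ladd _ _ hm hord _ (part_spherical a) _). Qed.

(** The exchanged letter lies in the word of [x], since a deletion in [y] would make [j] a descent
    of [y]. *)
Lemma parabolic_conj (K : set I) x y j : parabolic K x -> ~~ rdes y j ->
  rdes (x * y) j -> parabolic K (y * s j * y^-1).
Proof.
move=> /parabolicP[u Ku <-]; have [v [<- sv]] := reduced_word_ex y => asc.
rewrite -coxeter_word_cat => des; have [u1 [k [u2 [uv E]]]] := exchange des.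
have [[q [uE qE]]|[q [qE vE]]] := cat_eq_cat_cons uv; rewrite qE in E.
  apply/parabolicP; exists (rev u ++ (u1 ++ q)).
    move: Ku; rewrite J_word_cat J_word_rev uE !J_word_cat /= => /and3P[-> -> ->] //.
  move: E; rewrite catA !coxeter_word_cat coxeter_word_rev.
  move=> /(congr1 (fun x : W => x * (word v)^-1)); rewrite mulgK => <-.
  by rewrite -!mulgA mulKg.
move: E; rewrite -catA !coxeter_word_cat -mulgA => /mulgI E.
have := length_asc asc; rewrite E -coxeter_word_cat => lE.
have := length_word m (q ++ u2); rewrite lE -sv vE !size_cat /= addnS.
by rewrite ltnNge leqnSn.
Qed.

Lemma parabolic_gen_ind (K : set I) (L : set I) y :
    (forall i, K i -> parabolic L (y * s i * y^-1)) ->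
  forall x, parabolic K x -> parabolic L (y * x * y^-1).
Proof.
move=> gens x /parabolicP[u Ku <-]; elim: u Ku => [_|i u IHu /andP[/set_mem Ki Ku]].
  by rewrite coxeter_word_nil mulg1 mulgV; exact: gen1.
rewrite coxeter_word_cons.
have -> : y * (s i * word u) * y^-1 = (y * s i * y^-1) * (y * word u * y^-1).
  by rewrite -!mulgA mulKg.
by apply: genM; [exact: gens|exact: IHu].
Qed.

Lemma parabolic_ladd (K : set I) y x : J_min K y -> parabolic K x -> ladd y x.
Proof.
move=> yK /parabolicP[u Ku <-]; have [v [Kv <- sv]] := J_word_reduced m Ku.
by rewrite /ladd (J_min_add yK Kv sv) -sv.
Qed.

(** Conjugation by [psi v] sends [r a] into the parabolic subgroup of [b], and its inverse sends
    [r b] into that of [a], both without change of length. So [r a] and [r b] have equal lengths,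
    and the conjugate of [r b], being of maximal length, is [r a]. *)
Lemma psi_folding b v a : J_min (val a) (psi v) -> psi_des (st b * v) a ->
  psi (st b * v) = psi (v * st a).
Proof.
move=> asc des; have := psi_min_ladd asc; have := psi_des_ladd des.
rewrite !psiM !psi_gen; set B := r b; set A := r a; set y := psi v => l1 l2.
have A0 : (0 < length A)%N by exact: fold_gen_length.
have B2 : B * B = 1 by exact: fold_gen2.
have A2 : A * A = 1 by exact: fold_gen2.
have AV : A^-1 = A by exact: fold_genV.
have BV : B^-1 = B by exact: fold_genV.
have yV : psi v^-1 = y^-1 by exact: psiV.
have l1E : length (B * y) = (length (B * y * A) + length A)%N.
  by move: l1; rewrite /ladd -(coxeter_mulA _ A A) A2 mulg1 => /eqP.
have l2E : length (y * A) = (length y + length A)%N by exact/eqP.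
(* Admissibility at inverses governs left multiplication by [B]; the lengths leave only ascents for
   [y] and descents for [y * A]. *)
have [ascb|desb] := psi_dichotomy v^-1 b; last first.
  exfalso; have := psi_des_ladd desb; rewrite yV -/B laddV invgM invgK BV.
  rewrite /ladd coxeter_mulA B2 mul1g => /eqP l3.
  have := lengthM B (B * y * A); rewrite -!coxeter_mulA (coxeter_mulA B B) B2 mul1g.
  by rewrite !coxeter_mulA; move: l1E l2E l3 A0; length_lia.
have l3 : length (B * y) = (length B + length y)%N.
  by have := psi_min_ladd ascb; rewrite yV laddV BV invgK => /eqP.
have [ascb'|desb'] := psi_dichotomy (v * st a)^-1 b.
  exfalso; have := psi_min_ladd ascb'; rewrite psiV psiM psi_gen -/A -/y laddV invgK BV.
  by rewrite /ladd coxeter_mulA => /eqP; move: l1E l2E l3 A0; length_lia.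
have parA : parabolic (val a) A by have [] := longest_spec (part_spherical a).
have parB : parabolic (val b) B by have [] := longest_spec (part_spherical b).
have conjb : parabolic (val a) (y^-1 * B * y).
  rewrite -[X in _ * X]invgK; apply: parabolic_gen_ind parB => i bi.
  apply: (parabolic_conj parA); first by have := ascb i bi; rewrite yV.
  by have := desb' i bi; rewrite psiV psiM psi_gen -/A -/y invgM AV.
have conja : parabolic (val b) (y * A * y^-1).
  apply: parabolic_gen_ind parA => j aj.
  apply: (parabolic_conj parB); first exact: asc.
  by have := des j aj; rewrite psiM psi_gen.
have lB : length (y^-1 * B * y) = length B.
  have := parabolic_ladd asc conjb; rewrite /ladd -/y !coxeter_mulA mulgV mul1g l3.
  by move=> /eqP; length_lia.
have lA : length (y * A * y^-1) = length A.
  have yb : J_min (val b) y^-1 by rewrite -yV.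
  have conjaV : parabolic (val b) (y * A * y^-1)^-1.
    by rewrite -div1g; apply: genF => //; exact: gen1.
  have := parabolic_ladd yb conjaV; rewrite laddV !invgK /ladd mulgVK l2E.
  by move=> /eqP; length_lia.
have [_ maxA] := longest_spec (part_spherical a).
have [_ maxB] := longest_spec (part_spherical b).
have := maxA _ conjb; have := maxB _ conja; rewrite lA lB -/(r a) -/(r b) -/A -/B.
move=> leAB leBA.
have E : y^-1 * B * y = A.
  apply: (parabolic_length hm hord (part_spherical a)) => //.
  by rewrite lB; apply/eqP; rewrite eqn_leq leBA.
by rewrite -E !coxeter_mulA mulgV mul1g.
Qed.

Lemma psi_alt n a b : psi (wordt (alt n a b)) = alt_prod n (r a) (r b).
Proof. by rewrite psi_word /alt_prod -map_alt big_map. Qed.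

Lemma psi_alt_asc k a b :
    (forall n, (0 < n <= k)%N -> (r b * r a) ^+ n <> 1) ->
  J_min (val a) (psi (alt_end mt k a b)).
Proof.
elim: k => [|k IHk] ord.
  by rewrite /alt_end coxeter_word_nil psi1 => i _; rewrite rdes1.
have [//|des] := psi_dichotomy (alt_end mt k.+1 a b) a; exfalso.
have {}IHk : J_min (val a) (psi (alt_end mt k a b)).
  by apply: IHk => n nk; apply: ord; lia.
rewrite alt_endS in des; have := psi_folding IHk des; rewrite -alt_endS.
rewrite /alt_end -[st a]coxeter_genV !coxeter_word_rev -invgM !psiV => /invg_inj.
rewrite psiM psi_gen !psi_alt -alt_prodS => /alt_prod_comm.
by move=> /(_ (fold_gen2 b) (fold_gen2 a)); apply: ord; lia.
Qed.

Let hmt := fold_matrix.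
Let hordt := fold_order.

Lemma alt_end_rdes k a b : length (alt_end mt k b a) = k -> (0 < k)%N ->
  rdes (alt_end mt k b a) a.
Proof.
case: k => // k; rewrite /alt_end rev_cons => lk _.
have [] := @reduced_rcons _ mt (rev (alt k b a)) a => //.
by rewrite lk size_rcons size_rev size_alt.
Qed.

Lemma parabolic_rdes (K : set I) y x i : J_min K y -> parabolic K x -> K i ->
  rdes (y * x) i -> rdes x i.
Proof.
move=> yK /parabolicP[u Ku <-]; have [v [Kv <- sv]] := J_word_reduced m Ku.
by apply: J_decompose_des; rewrite // (J_min_add yK Kv sv).
Qed.

(* Dyer-Deodhar style induction: split off the dihedral part of [v] at [a]    *)
(* and a right descent [b]; the rest is handled by induction, the dihedral    *)
(* part by [psi_alt_asc].                                                     *)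
Lemma psi_asc v a : ~~ rdes v a -> J_min (val a) (psi v).
Proof.
have [n] := ubnP (length v); elim: n v a => // n IHn v a; rewrite ltnS => vn va.
have [->|v1] := pselect (v = 1); first by rewrite psi1 => i _; rewrite rdes1.
have [b vb] := rdes_neq1 v1.
set K := [set c | c = a \/ c = b]; have [y [u [vE yK Ku vl]]] := J_decompose K v.
have u0 : (0 < size u)%N.
  case: u vE Ku vl => // vE _ _; move: vb; rewrite vE coxeter_word_nil mulg1.
  by rewrite (negPf (yK b _)) //; right.
have yn : (length y < n)%N by rewrite vl in vn; lia.
have ya : J_min (val a) (psi y) by apply: IHn => //; apply: yK; left.
have yb : J_min (val b) (psi y) by apply: IHn => //; apply: yK; right.
have su : size u = length (wordt u).
  have := lengthM y (wordt u); have := length_word mt u; rewrite -vE vl; lia.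
have ua : ~~ rdes (wordt u) a.
  apply: contra va; rewrite /rdes vE -coxeter_mulA -vE vl => ua.
  by rewrite (leq_ltn_trans (lengthM _ _)) // ltn_add2l su.
have uE : wordt u = alt_end mt (size u) a b.
  have [//|E] := dihedral_word Ku su; exfalso; move/negP: ua; apply.
  by rewrite E; apply: alt_end_rdes => //; rewrite -E.
have ord k : (0 < k <= size u)%N -> (r b * r a) ^+ k <> 1.
  move=> /andP[k0 ku] E; have [l mba] := order_exists k0 E.
  have [l0 _ /(_ k E) lk] := order_Some mba.
  have mba' : mt b a = Some l by [].
  have mab : mt a b = Some l by case: hmt => mC _ _; rewrite mC.
  have lu : (l <= size u)%N := leq_trans (dvdn_leq k0 lk) ku.
  have ul : size u = l.
    apply/eqP; rewrite eqn_leq lu andbT leqNgt; apply/negP => lt.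
    by have := alt_end_long hmt mab lt; rewrite -uE -su ltnn.
  move/negP: ua; apply; have [E1 E2] := alt_end_braid mab.
  have {}E2 : wordt u = alt_end mt (size u) b a by rewrite uE ul E1 E2.
  by rewrite E2; apply: alt_end_rdes => //; rewrite -E2.
have uasc := psi_alt_asc ord; rewrite -uE in uasc.
move=> i ai; rewrite vE psiM; apply/negP.
have yab : J_min (val a `|` val b) (psi y) by move=> k [/ya|/yb].
have par : parabolic (val a `|` val b) (psi (wordt u)).
  have sub c : K c -> parabolic (val a `|` val b) (r c).
    move=> Kc; have [/parabolicP[q cq qE] _] := longest_spec (part_spherical c).
    apply/parabolicP; exists q => //; apply: sub_all cq => k /set_mem ck.
    by apply/mem_set; case: Kc ck => ->; [left|right].
  rewrite psi_word; elim: (u) Ku => [|c q IHq]; first by rewrite big_nil => _; exact: gen1.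
  by case/andP => /set_mem Kc /IHq qK; rewrite big_cons; apply: genM => //; exact: sub.
by move=> /(parabolic_rdes yab par (or_introl ai)); apply/negP/uasc.
Qed.

(** Otherwise, by [psi_asc] at [v * st a], multiplying twice by [r a] would add its length twice and
    yet return to [psi v]. *)
Lemma psi_rdes v a : rdes v a -> psi_des v a.
Proof.
move=> va; have [asc|//] := psi_dichotomy v a; exfalso.
have asc' : J_min (val a) (psi (v * st a)) by apply: psi_asc; rewrite rdesN negbK.
have := psi_min_ladd asc; have := psi_min_ladd asc'; rewrite psiM psi_gen /ladd.
rewrite -coxeter_mulA fold_gen2 mulg1 => /eqP E1 /eqP E2.
have := fold_gen_length a; move: E1 E2; length_lia.
Qed.

Lemma psi_rdesE v a i : val a i -> rdes (psi v) i = rdes v a.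
Proof.
move=> ai; have [/psi_rdes /(_ i ai)//|/psi_asc /(_ i ai) /negPf //] := boolP (rdes v a).
Qed.

Lemma psi_injective : injective psi.
Proof.
suff inj1 v : psi v = 1 -> v = 1.
  by move=> v v' E; apply: divg1_eq; apply: inj1; rewrite psiM psiV E mulgV.
move=> pv; apply: contrapT => /rdes_neq1[a va]; have [i ai] := part_nonempty a.
by have := psi_rdes va ai; rewrite pv rdes1.
Qed.

Lemma psi_ladd v v' : ladd v v' -> ladd (psi v) (psi v').
Proof.
have [u [<- su]] := reduced_word_ex v'; elim/last_ind: u su => [|u a IHu] su.
  by rewrite coxeter_word_nil psi1 !ladd1r.
have [su' des] := reduced_rcons su; rewrite coxeter_word_rcons rdesN -ladd_gen in des.
rewrite coxeter_word_rcons => l; have [l1 l2] := laddAl l des.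
rewrite psiM psi_gen; have := IHu su' l1 => l3.
have : ladd (psi (v * wordt u)) (r a).
  by apply/psi_min_ladd/psi_asc; rewrite -ladd_gen.
by rewrite psiM => /(laddAr l3)[].
Qed.

Lemma psi_weak_le v v' : weak_le v v' -> weak_le (psi v) (psi v').
Proof. by case/weak_leP => t -> /psi_ladd l; rewrite psiM weak_leM. Qed.

(** If the largest prefix on the side of [m] exceeded [psi M], it would admit one more letter [s i].
    By [psi_rdesE] the generator of the part containing [i] could then be added to [M], against
    maximality. *)
Lemma psi_grab v v' : grab (psi v) (psi v') = psi (grab v v').
Proof.
have [Mv' vM Mmax] := grabP hmt hordt v v'; set M := grab v v' in Mv' vM Mmax *.
have [Nv' vN Nmax] := grabP hm hord (psi v) (psi v').
set N := grab (psi v) _ in Nv' vN Nmax *.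
have MN : weak_le (psi M) N by apply: Nmax; [exact: psi_weak_le|exact: psi_ladd].
apply: contrapT => NM; have [|i Mi iN] := weak_le_step MN; first by move/esym.
have [a ai] := part_cover i.
have : headroom (psi v) (psi v') (psi M * s i).
  by apply: headroom_le iN _; rewrite /headroom Nv' vN.
case/andP => iv' vi; have [t v'E Mt] := weak_leP Mv'; rewrite v'E psiM in iv'.
have [+ _] := weak_le_left_des Mi iv'; rewrite -psiV (psi_rdesE _ ai) => ta.
have at_ : ladd (st a) (st a * t).
  by rewrite laddV invgM coxeter_genV ladd_gen rdesN negbK.
have [Ma Mat] : ladd M (st a) /\ ladd (M * st a) (st a * t).
  by apply: laddAl => //; rewrite coxeter_genKl.
have Mi' : ladd (psi M) (s i) by rewrite ladd_gen.
have [_] := laddAl vi Mi'; rewrite ladd_gen -psiM (psi_rdesE _ ai) -ladd_gen => vMa.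
have [vMa' _] := laddAr vM vMa.
have /weak_le_length : weak_le (M * st a) M.
  apply: Mmax => //; rewrite v'E -(coxeter_genKl a t) coxeter_mulA weak_leM //.
by rewrite (eqP Ma) length_gen addn1 ltnn.
Qed.

Lemma psi_act v (l : seq Wt) :
  act (psi v) [seq psi t | t <- l] = [seq psi t | t <- act v l].
Proof.
elim: l v => [|t l IHl] v /=.
  by rewrite -psi1 (inj_eq psi_injective); case: ifP.
by rewrite psi_grab -psiV -!psiM IHl.
Qed.

(** * The folding on words and on lifts *)

Definition fold_letter a : seq I :=
  sval (cid (longest_word (part_spherical a))).

Lemma fold_letterP a : word (fold_letter a) = r a /\ size (fold_letter a) = length (r a).
Proof. by rewrite /fold_letter; case: cid => u []. Qed.

Definition fold_word (u : seq (set_type P)) : seq I := flatten [seq fold_letter a | a <- u].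

Lemma artin_fold_letter a : artin_word m (fold_letter a) = artin_lift (r a).
Proof.
have [wE sE] := fold_letterP a.
by rewrite -wE (artin_liftE hm hord) // wE.
Qed.

Lemma artin_fold_word u : artin_word m (fold_word u) = \prod_(a <- u) artin_lift (r a).
Proof.
elim: u => [|a u IHu]; first by rewrite big_nil /artin_word big_nil.
by rewrite big_cons -IHu -artin_fold_letter -artin_word_cat.
Qed.

Lemma act_fold_word u (l : seq Wt) :
  act_word (fold_word u) [seq psi t | t <- l] = [seq psi t | t <- act_word u l].
Proof.
elim: u => // a u IHu; rewrite -[fold_word _]/(fold_letter a ++ fold_word u).
rewrite act_word_cat IHu -[act_word (a :: u) l]/(act (st a) (act_word u l)).
have [wE sE] := fold_letterP a.
rewrite (act_wordE hm hord) ?wE // -psi_gen.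
exact: psi_act.
Qed.

Lemma lift_psi u : size u = length (wordt u) ->
  \prod_(a <- u) artin_lift (r a) = artin_lift (psi (wordt u)).
Proof.
elim: u => [|a u IHu]; first by rewrite big_nil coxeter_word_nil psi1 artin_lift1.
rewrite coxeter_word_cons => sz; have su : size u = length (wordt u).
  have := lengthM (st a) (wordt u); have := length_word mt u.
  by rewrite -sz length_gen /=; lia.
rewrite big_cons IHu // -artin_liftM //; first by rewrite psiM psi_gen.
by rewrite -psi_gen; apply: psi_ladd; rewrite /ladd -sz length_gen /= -su.
Qed.

(** Both sides are reduced with the same value, so by [lift_psi] both products lift one element. *)
Lemma lift_psi_braid a b n : mt a b = Some n ->
  \prod_(c <- alt n a b) artin_lift (r c) = \prod_(c <- alt n b a) artin_lift (r c).
Proof.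
move=> mab; have la := length_alt hordt mab.
by rewrite !lift_psi ?size_alt -?(coxeter_braidE mab).
Qed.

End Folding.

(** * Fractions and injectivity *)

Section Fractions.
Variables (I : Type) (m : I -> I -> option nat).
Hypothesis hm : coxeter_matrix m.
Hypothesis hord : forall i j n, (0 < n)%N ->
  (coxeter_gen m i * coxeter_gen m j) ^+ n = 1 ->
  exists2 k, m i j = Some k & (k %| n)%N.
Variable z : coxeter_group m.
Hypothesis zdes : forall i, rdes z i.
Notation s := (coxeter_gen m).
Notation g := (artin_gen m).
Notation lift := (@artin_lift I m).
Let delta2 := lift z * lift z.

Lemma lift_full_gen i : exists j,
  lift z * g i = g j * lift z /\ lift z * g j = g i * lift z.
Proof.
have [j zi zj] := full_gen hm hord zdes i; exists j.
have main (a b : I) : z * s a = s b * z -> lift z * g a = g b * lift z.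
  move=> zab; rewrite -{1}[z](coxeter_genKl b) -zab (artin_liftM hm hord); last first.
    by rewrite zab; exact: full_ladd_l.
  rewrite -!(artin_lift_gen hm hord) -mulgA -(@artin_liftM _ _ hm hord (z * s a)).
    by rewrite coxeter_genK.
  by rewrite ladd_gen rdesN zdes.
by split; apply: main.
Qed.

Lemma delta2C i : delta2 * g i = g i * delta2.
Proof.
have [j [E1 E2]] := lift_full_gen i.
by rewrite /delta2 -mulgA E1 !mulgA E2.
Qed.

Lemma delta2XC n i : delta2 ^+ n * g i = g i * delta2 ^+ n.
Proof.
elim: n => [|n IHn]; first by rewrite mul1g mulg1.
by rewrite expgS -(mulgA delta2) IHn (mulgA delta2) delta2C -(mulgA (g i)).
Qed.

Lemma delta2_word n : exists u, artin_word m u = delta2 ^+ n.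
Proof.
have [v [vz sv]] := reduced_word_ex z.
have vE : artin_word m v = lift z by rewrite -vz (artin_liftE hm hord) // vz.
elim: n => [|n [u IHu]]; first by exists [::]; rewrite /artin_word big_nil.
by exists (v ++ (v ++ u)); rewrite !artin_word_cat IHu expgS vE mulgA.
Qed.

(** An inverse letter is absorbed by one factor [delta2], which is the generator times a positive
    element. *)
Lemma fractions x : exists n u, delta2 ^+ n * x = artin_word m u.
Proof.
elim/pres_class_ind: x => w; elim: w => [|[i b] w [n [u E]]].
  by exists 0%N, [::]; rewrite /artin_word big_nil mul1g.
set x := pres_class _ w in E.
case: b.
  exists n, (i :: u); rewrite /artin_word big_cons -/(artin_word m u) -E mulgA -delta2XC.
  by rewrite -(mulgA (delta2 ^+ n)); congr (_ * _); rewrite [RHS]pres_mulE.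
have -> : pres_class (artin_rel m) ((i, false) :: w) = (g i)^-1 * x.
  by rewrite [(g i)^-1]pres_invE [RHS]pres_mulE.
have [v [vz sv]] := reduced_word_ex (s i * z).
have [v' [v'z sv']] := reduced_word_ex z.
exists n.+1, (v ++ (v' ++ u)); rewrite !artin_word_cat -E.
have -> : artin_word m v = lift (s i * z) by rewrite -vz (artin_liftE hm hord) // vz.
have -> : artin_word m v' = lift z by rewrite -v'z (artin_liftE hm hord) // v'z.
have dE : delta2 = g i * (lift (s i * z) * lift z).
  rewrite mulgA -(artin_lift_gen hm hord) -(artin_liftM hm hord).
    by rewrite coxeter_genKl.
  exact: full_ladd_l.
apply: (mulgI (g i)); rewrite mulgA -delta2XC -(mulgA (delta2 ^+ n.+1)) mulVKg.
by rewrite expgS; set p := _ ^+ n; rewrite dE -!mulgA.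
Qed.

End Fractions.

(** * The homomorphism of Artin-Tits groups *)

Section Conclusion.
Variables (I : Type) (m : I -> I -> option nat) (P : set (set I)).
Hypotheses (hm : coxeter_matrix m) (hP : admissible m P).
Hypothesis hsph : spherical_matrix (partition_type m P).
Notation mt := (partition_type m P).
Let St := [set artin_lift (longest m a) | a in P].

Lemma fold_artin_ex : exists phi : {multiplicative artin_group mt -> artin_group m},
  forall a : set_type P, phi (artin_gen mt a) = artin_lift (longest m (val a)).
Proof.
have [psi psi_gen] := fold_ex hm hP.
have psiM v v' : psi (v * v') = psi v * psi v' by exact: gmulfM.
apply: pres_lift => u v [a b n mab].
exact: (lift_psi_braid hm hP psiM psi_gen mab).
Qed.

Lemma full_descents_ex : exists z : coxeter_group mt, forall a, rdes z a.
Proof.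
have sph : spherical mt setT by apply: sub_finite_set hsph.
by exists (longest mt setT) => a; apply: longest_des.
Qed.

Variable phi : {multiplicative artin_group mt -> artin_group m}.
Hypothesis phi_gen : forall a : set_type P,
  phi (artin_gen mt a) = artin_lift (longest m (val a)).

Lemma fold_artin_injective : injective phi.
Proof.
suff inj1 x : phi x = 1 -> x = 1.
  by move=> x y E; apply: divg1_eq; apply: inj1; rewrite gmulfM multV E mulgV.
move=> px.
have [psi psi_gen] := fold_ex hm hP.
have psiM v v' : psi (v * v') = psi v * psi v' by exact: gmulfM.
pose hord := coxeter_gen_order hm.
pose hmt := fold_matrix hm hP.
pose hordt := fold_order psiM psi_gen.
have [z zdes] := full_descents_ex.
have psiz_des i : rdes (psi z) i.
  have [a ai] := part_cover hP i.
  by rewrite (psi_rdesE hm hP psiM psi_gen z ai).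
have [n [u uE]] := fractions hmt hordt zdes x.
have [u0 u0E] := delta2_word hmt hordt z n.
have phi_word v : phi (artin_word mt v) = artin_word m (fold_word hP v).
  rewrite (artin_fold_word hm hP) mult_prod.
  by apply: eq_bigr => a _; exact: phi_gen.
have E : artin_word m (fold_word hP u) = artin_word m (fold_word hP u0).
  by rewrite -!phi_word -uE u0E gmulfM px mulg1.
have [k] := artin_word_act hm hord psiz_des E.
(* The empty list is written as an image under [psi], so that the whole computation is the image of
   one over [mt]. *)
move=> /(_ [seq psi t | t <- [::]]); rewrite !(act_fold_word hm hP psiM psi_gen).
have sqE (l : seq (coxeter_group mt)) : iter k (act_square (psi z)) [seq psi t | t <- l] =
    [seq psi t | t <- iter k (act_square z) l].
  elim: k => //= k ->; rewrite /act_square.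
  by rewrite !(psi_act hm hP psiM psi_gen).
rewrite !sqE => /(inj_map (psi_injective hm hP psiM psi_gen)).
have liftE v : \prod_(t <- iter k (act_square z) (act_word v [::])) artin_lift t =
    (artin_lift z * artin_lift z) ^+ k * artin_word mt v.
  elim: k {E sqE} => [|k IHk] /=.
    rewrite mul1g; elim: v => [|a v IHv]; first by rewrite /artin_word !big_nil.
    rewrite /= (act_lift hmt hordt) IHv (artin_lift_gen hmt hordt).
    by rewrite /artin_word big_cons.
  by rewrite /act_square !(act_lift hmt hordt) IHk expgS !mulgA.
move=> /(congr1 (fun l => \prod_(t <- l) artin_lift t)); rewrite !liftE.
by move=> /mulgI; rewrite -uE u0E => /(canRL (mulKg _)); rewrite mulVg.
Qed.

Lemma gen_fold_artin x : gen St (phi x).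
Proof.
elim/pres_class_ind: x => w; elim: w => [|[a b] w IHw].
  by rewrite -[pres_class _ _]/(1 : artin_group mt) mult1; exact: gen1.
have ga : gen St (phi (artin_gen mt a)).
  by rewrite phi_gen; apply: sub_gen; exists (val a) => //; exact: part_mem.
have -> : pres_class (artin_rel mt) ((a, b) :: w) =
    (if b then artin_gen mt a else (artin_gen mt a)^-1) * pres_class _ w.
  by case: b; rewrite ?[(artin_gen mt a)^-1]pres_invE [RHS]pres_mulE.
rewrite gmulfM; apply: genM => //; case: b => //.
by rewrite multV -div1g; apply: genF => //; exact: gen1.
Qed.

Lemma gen_fold_artin_surj y : gen St y -> exists x, phi x = y.
Proof.
move: y; apply: gen_sub => [|_ _ [x <-] [y <-]|_ [J PJ <-]].
- by exists 1; exact: mult1.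
- by exists (x / y); rewrite gmulfM multV.
by exists (artin_gen mt (exist _ J (mem_set PJ))); rewrite phi_gen.
Qed.

(** The isomorphism is the inverse of [phi] on its image, built by choosing preimages. *)
Lemma fold_artin_pair_iso : pair_iso [set x : gen_group St | St (val x)]
  [set artin_gen mt a | a in [set: set_type P]].
Proof.
have ex (y : gen_group St) : exists x, phi x = val y.
  by apply: gen_fold_artin_surj; exact: set_mem (valP y).
pose f y := sval (cid (ex y)); have fE y : phi (f y) = val y := svalP (cid (ex y)).
have fM : {morph f : x y / x * y}.
  by move=> x y; apply: fold_artin_injective; rewrite gmulfM !fE valM.
pose F : {multiplicative gen_group St -> artin_group mt} :=
  HB.pack f (isMultiplicative.Build _ _ f fM).
exists F; split.
  pose h x : gen_group St := exist _ (phi x) (mem_set (gen_fold_artin x)).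
  exists h => [y|x]; first by apply: val_inj; exact: fE.
  by apply: fold_artin_injective; exact: fE.
apply/seteqP; split=> [_ [y [J PJ Jy] <-]|_ [a _ <-]].
  exists (exist _ J (mem_set PJ)) => //; apply: fold_artin_injective.
  by rewrite [RHS]fE phi_gen.
exists (exist _ (phi (artin_gen mt a)) (mem_set (gen_fold_artin _))).
  by exists (val a); [exact: part_mem|rewrite /= phi_gen].
by apply: fold_artin_injective; exact: fE.
Qed.

End Conclusion.

Theorem theorem24 (I : Type) (m : I -> I -> option nat) (P : set (set I))
    (hm : coxeter_matrix m) (hP : admissible m P)
    (hsph : spherical_matrix (partition_type m P)) :
  let mt := partition_type m P in
  let St := [set artin_lift (longest m a) | a in P] in
  [/\ (exists phi : {multiplicative artin_group mt -> artin_group m},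
         forall a : set_type P,
           phi (artin_gen mt a) = artin_lift (longest m (val a))),
      (forall phi : {multiplicative artin_group mt -> artin_group m},
         (forall a : set_type P,
            phi (artin_gen mt a) = artin_lift (longest m (val a))) ->
         injective phi)
    & pair_iso [set x : gen_group St | St (val x)]
               [set artin_gen mt a | a in [set: set_type P]]].
Proof.
have [phi phi_gen] := fold_artin_ex hm hP.
split; first by exists phi.
  by move=> phi' phi_gen'; exact: (fold_artin_injective hm hP hsph).
exact: (fold_artin_pair_iso hm hP hsph phi_gen).
Qed.
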